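(* Let $T$ be an interval exchange transformation satisfying the Keane condition so that there exists $\sigma>0$ with $e_T(n)>\frac{\sigma}{n}$ for all $n$. Then for any decreasing sequence $\{r_i\}$ with divergent sum, $$\lim_{N\to\infty}\frac{\sum_{j=1}^N\chi_{B(\frac12,r_j)}(T^jx)}{\sum_{j=1}^N 2r_j}=1$$ for almost every $x$.
   Context: Interval exchange transformation (IET): given $(l_1,\dots,l_d)$ with $l_i\ge0$, $\sum_{i=1}^d l_i=1$, put $I_1=[0,l_1)$, $I_2=[l_1,l_1+l_2)$, ..., $I_d=[l_1+\dots+l_{d-1},1)$; given a permutation $\pi$ of $\{1,\dots,d\}$, the IET $T:[0,1)\to[0,1)$ is $T(x)=x-\sum_{k<j}l_k+\sum_{\pi(k')<\pi(j)}l_{k'}$ for $x\in I_j$. The discontinuities of $T$ are the points of $D=\{\sum_{i=1}^r l_i\}_{r=1}^{d-1}$, and the discontinuities of $T^n$ are the points of $\bigcup_{i=0}^{n-1}T^{-i}D$. $T$ satisfies the Keane condition if the orbits of all its discontinuities are infinite and disjoint. $e_T(n)$ is the minimum distance between two discontinuities of $T^n$ (and is defined to be $0$ if two discontinuities orbit into each other). $\{r_i\}$ is a sequence of radii, $B(\frac12,r)$ is the ball of radius $r$ about $\frac12$, and $\chi_A$ is the indicator function of $A$. ''Almost every'' is with respect to Lebesgue measure on $[0,1)$.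
   Formalization: Proved for d at least 2, nonnegative radii and lim r_j at most 1/2; if lim r_j > 1/2 (e.g. r_j = 1+1/j) every ball contains [0,1) and the ratio tends to 1/(2 lim r_j) < 1, and for d = 1 the map is the identity and the claim fails. *)

(* Defs.v *)
From HB Require Import structures.
From mathcomp Require Import all_boot all_order all_algebra all_fingroup.
From mathcomp Require Import all_classical all_reals all_analysis.
Import Order.TTheory GRing.Theory Num.Theory.
Import numFieldNormedType.Exports.
Set Implicit Arguments.
Unset Strict Implicit.
Unset Printing Implicit Defensive.
Local Open Scope classical_set_scope.
Local Open Scope ring_scope.

(* Intervals are numbered from 0: the index j : 'I_d stands for I_(j+1). *)

Definition left_end (R : realType) (d : nat) (l : 'I_d -> R) (r : nat) : R :=
  \sum_(i < d | (i < r)%N) l i.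

(* The intervals [left_end l j, left_end l j + l j) are disjoint and cover
   [0, 1), so for x in [0, 1) the outer sum has exactly one term; outside
   [0, 1) it is empty and the map is the identity. *)
Definition iet (R : realType) (d : nat) (l : 'I_d -> R) (pi : 'S_d) (x : R) : R :=
  x + \sum_(j < d | left_end l j <= x < left_end l j + l j)
        (\sum_(k < d | (pi k < pi j)%N) l k - left_end l j).

Definition discont (R : realType) (d : nat) (l : 'I_d -> R) : set R :=
  [set left_end l r | r in [set r : nat | (0 < r < d)%N]].

Definition discont_iter (R : realType) (d : nat) (l : 'I_d -> R) (pi : 'S_d)
    (n : nat) : set R :=
  \bigcup_(i in `I_n) (`[0, 1[ `&` iter i (iet l pi) @^-1` discont l).

Definition forward_orbit (T : Type) (f : T -> T) (x : T) : set T :=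
  range (fun n : nat => iter n f x).

(* As [iet l pi] is injective, forward, backward and two-sided orbits all give
   the same condition. *)
Definition keane (R : realType) (d : nat) (l : 'I_d -> R) (pi : 'S_d) : Prop :=
  (forall p, discont l p -> infinite_set (forward_orbit (iet l pi) p)) /\
  trivIset (discont l) (forward_orbit (iet l pi)).

(* Valued in the extended reals so that the value is +oo, and not a junk 0,
   when T^n has fewer than two discontinuities (d = 2 and n = 1, say). *)
Definition min_gap (R : realType) (d : nat) (l : 'I_d -> R) (pi : 'S_d)
    (n : nat) : \bar R :=
  if `[< exists p q, [/\ discont l p, discont l q, p <> q &
                         forward_orbit (iet l pi) p q] >] then 0%E
  else ereal_inf [set z | exists p q, [/\ discont_iter l pi n p,
                     discont_iter l pi n q, p <> q & z = `|p - q|%:E]].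

(* Main.v *)
Require Import Defs.
From HB Require Import structures.
From mathcomp Require Import all_boot all_order all_algebra all_fingroup.
From mathcomp Require Import all_classical all_reals all_analysis.
From mathcomp Require Import measurable_realfun lra ring zify.
Import Order.TTheory GRing.Theory Num.Theory.
Import numFieldNormedType.Exports.
Local Open Scope classical_set_scope.
Local Open Scope ring_scope.

(** Write [T] for the exchange, [b_j] for the measure of the [j]-th ball
    (so [b_j = min(1, 2 r_j)]), [F_N(x)] for the number of [j <= N] with
    [T^j x] in the [j]-th ball, and [E_N] for the sum of the [b_j].  As [T]
    preserves Lebesgue measure, [E_N] is the mean of [F_N].  Almost sure
    convergence of [F_N / E_N] to 1 follows from a bound on the variance:
    Chebyshev and Borel-Cantelli along indices at which [E_N] grows
    geometrically, then monotonicity of [F_N] and [E_N] in between.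

    The variance.  The balls are nested, so for a block of [w] consecutive
    times [i >= s], the sum over the block of the measures of
    [B_j /\ T^(-(i-j)) B_i] is at most the integral over [B_s] of the number
    of visits to [B_j] of an orbit segment of length [w]
    ([pair_block]).  If every segment of length [w >= Q / b_j] visits [B_j] at
    most [(1 + u) b_j w] times, each pair sum is therefore [1 + u] times the
    expected one, up to the first block ([pair_sum]), and the variance is at
    most [u E_N^2 + O(Q E_N)] ([second_moment]).  No decay of correlations
    between individual times enters: only averages over blocks do.  It remains
    to let [u] go to 0 with [Q] growing, fast enough for the series of
    deviation probabilities to converge; [u = a / m^2] with [Q = B^m] suffices
    ([equidistributed_rate], [deviation_bound]).

    Equidistribution.  That rate is a contraction argument.  Some segment of
    length [w] visits a ball of measure [L] at most about [L w] times, since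
    [L w] is the mean.  Every segment of length [(C + 1) w] contains a
    [K/w]-accurate copy of that one ([shadowing]), and so saves a fixed
    proportion of the excess of the worst segment ([equidistributed_step]).

    Linear recurrence.  Shadowing is what the hypothesis on the gaps gives.
    Two points have the same [n]-itinerary if no discontinuity of [T^n]
    separates them.  For a class of [n]-itineraries, the points that first
    enter it at time [i] form a set that is stable under [(n + i)]-itineraries,
    so it contains an interval of length at least [s / (n + i)] as soon as it
    is nonempty.  These sets are disjoint, and the harmonic series diverges,
    hence the first entrance time is at most [C n] or infinite
    ([first_hit_bound]); the latter is excluded because a nontrivial invariant
    union of classes would have a boundary point, all of whose preimages
    are discontinuities of a fixed iterate, contrary to the Keane condition
    ([invariant_trivial], [visits_every_class]).  Finally, classes are short:
    a long interval of continuity of [T^n] returns to itself quickly by measure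
    preservation, which makes the itinerary periodic for a long time, whereas
    an orbit must visit all of the more than [k] classes of rank [k + 1]
    ([no_quick_return], [class_diameter]). *)

(** * Lebesgue measure of the unit interval, as a positive functional *)

Definition umeas {R : realType} (A : set R) : R :=
  fine (@lebesgue_measure R (A `&` `[0, 1[)).

Lemma umeas_fin {R : realType} (A : set R) : measurable A ->
  (@lebesgue_measure R) (A `&` `[0, 1[) = (umeas A)%:E.
Proof.
move=> mA; rewrite /umeas fineK// ge0_fin_numE ?measure_ge0//.
apply: (@le_lt_trans _ _ (@lebesgue_measure R `[0, 1[)).
  apply: le_measure; rewrite ?inE//; first exact: measurableI.
by rewrite lebesgue_measure_itv/= lte_fin ltr01 -EFinB ltry.
Qed.

Lemma umeas_itv {R : realType} (a b : R) : 0 <= a -> a <= b -> b <= 1 ->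
  umeas `[a, b[ = b - a.
Proof.
move=> a0 ab b1; rewrite /umeas.
have -> : `[a, b[%classic `&` `[0, 1[%classic = `[a, b[%classic :> set R.
  apply/seteqP; split => x /=; rewrite !in_itv/=; first by case.
  by move=> /andP[ax xb]; split; apply/andP; split => //; [exact: le_trans ax|exact: lt_le_trans b1].
rewrite lebesgue_measure_itv/= lte_fin; case: ltP => //= ba.
by apply/esym/eqP; rewrite subr_eq0 eq_le ab ba.
Qed.

Lemma umeas_itvcc {R : realType} (a b : R) : a <= b -> umeas `[a, b] <= b - a.
Proof.
move=> ab; rewrite -lee_fin -umeas_fin//.
apply: (@le_trans _ _ (@lebesgue_measure R `[a, b])).
  apply: le_measure; rewrite ?inE//; first exact: measurableI.
rewrite lebesgue_measure_itv/= lte_fin; case: ltP => //= ba.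
by rewrite lee_fin subr_ge0.
Qed.

Lemma umeasT {R : realType} : umeas [set: R] = 1.
Proof.
rewrite /umeas setTI -[`[0, 1[%classic]setIid -/(umeas `[0, 1[).
by rewrite umeas_itv ?subr0.
Qed.

Lemma umeas_ge0 {R : realType} (A : set R) : 0 <= umeas A.
Proof. by rewrite fine_ge0 ?measure_ge0. Qed.

(** Linear relations between indicators pass to measures.  All the integrals of
    the proof (means, correlations, Chebyshev) are instances of this one
    statement, which keeps them in the real numbers. *)
Lemma umeas_comb_ge0 {R : realType} (I : Type) (s : seq I) (C : R)
    (c : I -> R) (A : I -> set R) :
  (forall i, measurable (A i)) ->
  (forall x : R, 0 <= x < 1 -> 0 <= C + \sum_(i <- s) c i * \1_(A i) x) ->
  0 <= C + \sum_(i <- s) c i * umeas (A i).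
Proof.
move=> mA h.
pose A' (o : option I) := if o is Some i then A i else [set: R].
pose c' (o : option I) := if o is Some i then c i else C.
have mA' o : measurable (A' o) by case: o => [i|] //=; exact: mA.
suff : 0 <= \sum_(o <- None :: map Some s) c' o * umeas (A' o).
  by rewrite big_cons big_map/= umeasT mulr1.
have {}h x : 0 <= x < 1 -> 0 <= \sum_(o <- None :: map Some s) c' o * \1_(A' o) x.
  by move=> /h; rewrite big_cons big_map/= indicT mulr1.
rewrite -lee_fin -sumEFin.
have intA o : (@lebesgue_measure R).-integrable `[0, 1[ (fun x => (\1_(A' o) x)%:E).
  apply: measurable_bounded_integrable => //=.
    by rewrite lebesgue_measure_itv/= lte_fin ltr01 -EFinB ltry.
    by apply: measurable_indic; exact: mA'.
  exists 1; split => // M M1 x _ /=; rewrite indicE.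
  by case: (_ \in _); rewrite ?normr1 ?normr0; lra.
have -> : (\sum_(o <- None :: map Some s) (c' o * umeas (A' o))%:E =
   \int[@lebesgue_measure R]_(x in `[0%R, 1%R[)
     (\sum_(o <- None :: map Some s) (c' o)%:E * (\1_(A' o) x)%:E))%E.
  rewrite integral_sum//; last by move=> o; apply: integrableZl.
  apply: eq_bigr => o _; rewrite integralZl// integral_indic//; last exact: mA'.
  by rewrite EFinM -umeas_fin.
apply: integral_ge0 => x /=; rewrite in_itv/= => /h hx.
under eq_bigr do rewrite -EFinM.
by rewrite sumEFin lee_fin.
Qed.

Lemma umeas_sum_le_indic {R : realType} (I : Type) (s : seq I) (C : R) (G : set R)
    (A : I -> set R) : measurable G -> (forall i, measurable (A i)) ->
  (forall x : R, 0 <= x < 1 -> \sum_(i <- s) \1_(A i) x <= C * \1_G x) ->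
  \sum_(i <- s) umeas (A i) <= C * umeas G.
Proof.
move=> mG mA h.
pose A' (o : option I) := if o is Some i then A i else G.
have mA' o : measurable (A' o) by case: o => [i|] //=; exact: mA.
have := @umeas_comb_ge0 _ _ (None :: map Some s) 0
  (fun o => if o is Some _ then -1 else C) A' mA'.
rewrite add0r big_cons big_map/= -mulr_sumr mulN1r subr_ge0; apply => x /h.
by rewrite add0r big_cons big_map/= -mulr_sumr mulN1r subr_ge0.
Qed.

Lemma umeas_sum_le {R : realType} (I : Type) (s : seq I) (C : R)
    (A : I -> set R) : (forall i, measurable (A i)) ->
  (forall x : R, 0 <= x < 1 -> \sum_(i <- s) \1_(A i) x <= C) ->
  \sum_(i <- s) umeas (A i) <= C.
Proof.
move=> mA h; rewrite -[C]mulr1 -umeasT; apply: umeas_sum_le_indic => // x.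
by rewrite indicT mulr1; exact: h.
Qed.

Lemma umeas_sum_ge {R : realType} (I : Type) (s : seq I) (C : R)
    (A : I -> set R) : (forall i, measurable (A i)) ->
  (forall x : R, 0 <= x < 1 -> C <= \sum_(i <- s) \1_(A i) x) ->
  C <= \sum_(i <- s) umeas (A i).
Proof.
move=> mA h; have := @umeas_comb_ge0 _ _ s (- C) (fun=> 1) A mA.
under eq_bigr do rewrite mul1r.
rewrite addrC subr_ge0; apply => x /h.
by under [in X in _ -> X]eq_bigr do rewrite mul1r; rewrite addrC subr_ge0.
Qed.

Lemma umeas_le {R : realType} (A B : set R) : measurable A -> measurable B ->
  (forall x, 0 <= x < 1 -> A x -> B x) -> umeas A <= umeas B.
Proof.
move=> mA mB AB.
have := @umeas_comb_ge0 _ _ [:: true; false] 0 (fun b => if b then 1 else -1)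
  (fun b => if b then B else A).
rewrite !add0r !big_cons !big_nil/= !addr0 mul1r mulN1r subr_ge0; apply.
  by case.
move=> x x01; rewrite add0r !big_cons !big_nil/= addr0 mul1r mulN1r subr_ge0.
rewrite !indicE; have [/set_mem Ax|//] := boolP (x \in A).
by rewrite mem_set//; exact: AB.
Qed.

Lemma umeas_sum_eq {R : realType} (I : Type) (s : seq I) (B : set R)
    (A : I -> set R) : measurable B -> (forall i, measurable (A i)) ->
  (forall x : R, 0 <= x < 1 -> \1_B x = \sum_(i <- s) \1_(A i) x :> R) ->
  umeas B = \sum_(i <- s) umeas (A i).
Proof.
move=> mB mA h.
pose A' (o : option I) := if o is Some i then A i else B.
have mA' o : measurable (A' o) by case: o => [i|] //=; exact: mA.
have h1 e := @umeas_comb_ge0 _ _ (None :: map Some s) 0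
  (fun o => if o is Some _ then e else - e) A' mA'.
have {}h1 e : 0 <= - e * umeas B + e * \sum_(i <- s) umeas (A i).
  have := h1 e; rewrite add0r big_cons big_map/= mulr_sumr; apply => x x01.
  rewrite add0r big_cons big_map/= h// -mulr_sumr; lra.
by apply/eqP; rewrite eq_le; have := h1 1; have := h1 (-1); lra.
Qed.

Lemma lebesgue_measure_translate {R : realType} (t : R) (A : set R) : measurable A ->
  @lebesgue_measure R ((fun x => x + t) @^-1` A) = @lebesgue_measure R A.
Proof.
move=> mA.
have mf : measurable_fun [set: R] ((fun x : R => x + t) : measurableTypeR R -> measurableTypeR R).
  exact: measurable_funD.
change (pushforward (@lebesgue_measure R)
  ((fun x : R => x + t) : measurableTypeR R -> measurableTypeR R) A = lebesgue_measure A).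
apply/esym/lebesgue_measure_unique => //= _ [[a b]] _ <-.
rewrite /pushforward.
have -> : (fun x : R => x + t) @^-1` `]a, b]%classic = `]a - t, b - t]%classic.
  by apply/seteqP; split => x /=; rewrite !in_itv/=; lra.
rewrite !lebesgue_measure_itv/= !lte_fin ltrD2r.
by case: ifP => // _; rewrite -!EFinB; congr EFin; lra.
Qed.

(** * Interval exchanges: bijectivity, measure preservation, translation cells *)

Definition cell {R : realType} {d : nat} (l : 'I_d -> R) (j : 'I_d) : set R :=
  `[left_end l j, left_end l j + l j[.

Section Cells.
Context {R : realType} {d : nat} (l : 'I_d -> R).
Hypothesis l0 : forall i, 0 <= l i.
Hypothesis l1 : \sum_(i < d) l i = 1.

Lemma left_endS (j : 'I_d) : left_end l j.+1 = left_end l j + l j.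
Proof.
rewrite /left_end (bigD1 j)//= addrC; congr (_ + _).
by apply: eq_bigl => i; rewrite ltnS ltn_neqAle andbC.
Qed.

Lemma left_end0 : left_end l 0 = 0.
Proof. by rewrite /left_end big_pred0. Qed.

Lemma left_end_all : left_end l d = 1.
Proof. by rewrite -l1 /left_end; apply: eq_bigl => i; rewrite ltn_ord. Qed.

Lemma left_end_le r s : (r <= s)%N -> left_end l r <= left_end l s.
Proof.
move=> rs; rewrite /left_end big_mkcond [leRHS]big_mkcond/=.
apply: ler_sum => i _; case: ifPn => [ir|_]; first by rewrite (leq_trans ir).
by case: ifP.
Qed.

Lemma left_end_itv (j : 'I_d) : 0 <= left_end l j /\ left_end l j + l j <= 1.
Proof.
rewrite -left_endS -left_end_all -left_end0; split; exact: left_end_le.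
Qed.

Lemma cell_unit (j : 'I_d) x : cell l j x -> 0 <= x < 1.
Proof. by rewrite /cell/= in_itv/=; have [] := left_end_itv j; lra. Qed.

Lemma cell_uniq (i j : 'I_d) x : cell l i x -> cell l j x -> i = j.
Proof.
suff h (a b : 'I_d) : cell l a x -> cell l b x -> (a < b)%N -> False.
  move=> xi xj; apply/val_inj => /=; case: (ltngtP i j) => // ij.
  - by case: (h i j).
  - by case: (h j i).
move=> + + /left_end_le; rewrite left_endS /cell/= !in_itv/=; lra.
Qed.

Lemma cell_cover x : 0 <= x < 1 -> exists j, cell l j x.
Proof.
move=> /andP[x0 x1].
have h : exists r, x < left_end l r by exists d; rewrite left_end_all.
case: (ex_minnP h) => -[|r] xr rmin; first by move: xr; rewrite left_end0; lra.
have rd : (r < d)%N.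
  by have := rmin d; rewrite left_end_all => /(_ x1).
exists (Ordinal rd); rewrite /cell/= in_itv/= -(left_endS (Ordinal rd))/= xr andbT.
by rewrite leNgt; apply/negP => /rmin; rewrite ltnn.
Qed.

(** The cells partition the unit interval, so a set can be measured cell by cell. *)
Lemma indic_cells (A : set R) x : 0 <= x < 1 ->
  \1_A x = \sum_(j < d) \1_(A `&` cell l j) x :> R.
Proof.
move=> /cell_cover[j xj]; rewrite (bigD1 j)//= big1 => [|i ij].
  rewrite addr0 !indicE in_setI [x \in cell l j]mem_set// andbT//.
rewrite indicE in_setI [x \in cell l i]memNset ?andbF// => xi.
by move: ij; rewrite (cell_uniq _ _ _ xi xj) eqxx.
Qed.

End Cells.

Section Iet.
Context {R : realType} {d : nat} (l : 'I_d -> R) (pi : 'S_d).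
Hypothesis l0 : forall i, 0 <= l i.
Hypothesis l1 : \sum_(i < d) l i = 1.

(** The image intervals, read from left to right, are the cells of this
    permuted length vector. *)
Definition image_length (i : 'I_d) : R := l ((pi^-1)%g i).

Lemma image_length_ge0 i : 0 <= image_length i.
Proof. exact: l0. Qed.

Lemma sum_image_length : \sum_(i < d) image_length i = 1.
Proof. by rewrite -l1 [RHS](reindex_inj (@perm_inj _ (pi^-1)%g)). Qed.

#[local] Hint Resolve image_length_ge0 sum_image_length : core.

Lemma image_left_end j :
  \sum_(k < d | (pi k < pi j)%N) l k = left_end image_length (pi j).
Proof.
rewrite /left_end [RHS](reindex_inj (@perm_inj _ pi))/=; apply: eq_bigr => k _.
by rewrite /image_length permK.
Qed.

Lemma image_cellE j x : cell image_length (pi j) x <->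
  left_end image_length (pi j) <= x < left_end image_length (pi j) + l j.
Proof. by rewrite /cell/= in_itv/= /image_length permK. Qed.

Lemma iet_cell j x : cell l j x ->
  iet l pi x = x + (left_end image_length (pi j) - left_end l j).
Proof.
move=> xj; rewrite /iet (bigD1 j)/=; last by move: xj; rewrite /cell/= in_itv.
rewrite [X in _ + (_ + X) = _]big1 => [|i /andP[xi ij]]; first by rewrite addr0 image_left_end.
case/eqP: ij; exact: (cell_uniq _ l0 _ _ x).
Qed.

Lemma iet_image j x : cell l j x -> cell image_length (pi j) (iet l pi x).
Proof.
move=> xj; rewrite (iet_cell _ _ xj) image_cellE.
by move: xj; rewrite /cell/= in_itv/=; lra.
Qed.

Lemma iet_unit x : 0 <= x < 1 -> 0 <= iet l pi x < 1.
Proof.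
move=> /(cell_cover _ l1)[j /iet_image].
exact: cell_unit.
Qed.

Lemma iet_inj x y : 0 <= x < 1 -> 0 <= y < 1 -> iet l pi x = iet l pi y -> x = y.
Proof.
move=> /(cell_cover _ l1)[i xi] /(cell_cover _ l1)[j yj] xy.
have ij : i = j.
  apply: (@perm_inj _ pi); apply: (cell_uniq image_length _ _ _ (iet l pi x)) => //.
    exact: iet_image.
  by rewrite xy; exact: iet_image.
by move: yj xy; rewrite -ij => yj; rewrite (iet_cell _ _ xi) (iet_cell _ _ yj); lra.
Qed.

Lemma iet_onto j y : cell image_length (pi j) y ->
  let x := y - left_end image_length (pi j) + left_end l j in
  cell l j x /\ iet l pi x = y.
Proof.
rewrite image_cellE => yj x; have xj : cell l j x.
  by rewrite /cell/= in_itv/= /x; lra.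
by split => //; rewrite (iet_cell _ _ xj) /x; lra.
Qed.

Lemma iet_surj y : 0 <= y < 1 -> exists x, 0 <= x < 1 /\ iet l pi x = y.
Proof.
move=> /(cell_cover _ sum_image_length)[i yi].
rewrite -[i](permKV pi) in yi; have [xj <-] := iet_onto _ _ yi.
by eexists; split; [exact: cell_unit xj|].
Qed.

Lemma iet_transl a b : 0 <= a -> b <= 1 ->
  (forall p, discont l p -> ~ a < p < b) ->
  forall x, a <= x < b -> iet l pi x - x = iet l pi a - a.
Proof.
move=> a0 b1 nd x /andP[ax xb].
have [j aj] : exists j, cell l j a by apply: (cell_cover _ l1); lra.
suff xj : cell l j x by rewrite (iet_cell _ _ xj) (iet_cell _ _ aj); lra.
move: aj; rewrite /cell/= !in_itv/= -left_endS => /andP[ja aj].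
rewrite (le_trans ja ax)/=; apply: (lt_le_trans xb).
rewrite leNgt; apply/negP => jb; apply: (nd (left_end l j.+1)); last by rewrite aj jb.
exists j.+1 => //=; case: (ltngtP j.+1 d) => // [dj|dj].
  by have := ltn_ord j; lia.
by move: jb; rewrite dj left_end_all//; lra.
Qed.

Lemma measurable_iet (A : set R) : measurable A -> measurable (iet l pi @^-1` A).
Proof.
move=> mA.
have mf : measurable_fun setT (iet l pi : measurableTypeR R -> measurableTypeR R).
  rewrite /iet; apply: measurable_funD; first exact: measurable_id.
  under eq_fun do rewrite big_mkcond/=.
  apply: measurable_sum => j.
  rewrite (_ : (fun _ => _) = fun x : R => \1_(cell l j) x *
    (\sum_(k < d | (pi k < pi j)%N) l k - left_end l j)).
    apply: measurable_funM; last exact: measurable_cst.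
    by apply: measurable_indic; exact: measurable_itv.
  apply/funext => x; rewrite indicE /cell; case: ifPn => h.
    by rewrite mem_set ?mul1r//= in_itv.
  by rewrite memNset ?mul0r//= in_itv/=; exact/negP.
by rewrite -[_ @^-1` _]setTI; exact: mf.
Qed.

(** On each cell the exchange is a translation onto an image cell, and both
    families of cells partition the unit interval. *)
Lemma umeas_iet (A : set R) : measurable A -> umeas (iet l pi @^-1` A) = umeas A.
Proof.
move=> mA.
have mcell (l' : 'I_d -> R) j : measurable (cell l' j) by exact: measurable_itv.
rewrite (@umeas_sum_eq _ _ (index_enum 'I_d) (iet l pi @^-1` A)
  (fun j => (iet l pi @^-1` A) `&` cell l j)); last 3 first.
- exact: measurable_iet.
- by move=> j; apply: measurableI => //; exact: measurable_iet.
- by move=> x; exact: indic_cells.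
rewrite (@umeas_sum_eq _ _ (index_enum 'I_d) A
  (fun j => A `&` cell image_length (pi j))); last 3 first.
- exact: mA.
- by move=> j; apply: measurableI.
- move=> x x01; rewrite (indic_cells image_length)//.
  by rewrite (reindex_inj (@perm_inj _ pi)).
apply: eq_bigr => j _; rewrite /umeas; congr fine.
have -> : A `&` cell image_length (pi j) `&` `[0, 1[%classic =
    A `&` cell image_length (pi j).
  by apply/setIidPl => x [_ /cell_unit]; rewrite /= in_itv/=; exact.
have -> : iet l pi @^-1` A `&` cell l j `&` `[0, 1[%classic =
   (fun x => x + (left_end image_length (pi j) - left_end l j)) @^-1`
     (A `&` cell image_length (pi j)).
  apply/seteqP; split => x /=.
    move=> [[xA xj] _]; rewrite (iet_cell _ _ xj) in xA; split => //.
    by rewrite -iet_cell//; exact: iet_image.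
  move=> [xA] /iet_onto[]; rewrite (_ : _ - _ + _ = x); last by lra.
  move=> xj ex; split; last by rewrite in_itv/=; exact: cell_unit xj.
  by split => //; rewrite (iet_cell _ _ xj).
by rewrite lebesgue_measure_translate//; exact: measurableI.
Qed.

End Iet.

(** * From the Keane condition to a separation estimate with end points *)

Definition disc_upto {R : realType} (T : R -> R) (D : set R) (n : nat) : set R :=
  [set x | 0 <= x < 1 /\ exists2 i, (i < n)%N & D (iter i T x)].

(** The properties of the exchange that the rest of the proof relies on.  Beyond
    the gaps between discontinuities of the iterates, the distances of these
    points to 0 and to 1 are bounded below as well: intervals of continuity
    touching an end point of the unit interval must not be too short either. *)
Record separated_exchange {R : realType} (T : R -> R) (D : set R) (s : R) : Prop := {
  exch_unit : forall x, 0 <= x < 1 -> 0 <= T x < 1;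
  exch_surj : forall y, 0 <= y < 1 -> exists x, 0 <= x < 1 /\ T x = y;
  exch_measurable : forall A, measurable A -> measurable (T @^-1` A);
  exch_umeas : forall A, measurable A -> umeas (T @^-1` A) = umeas A;
  exch_transl : forall a b, 0 <= a -> b <= 1 ->
    (forall p, D p -> ~ a < p < b) ->
    forall x, a <= x < b -> T x - x = T a - a;
  exch_orbit : forall p q k, D p -> D q -> iter k.+1 T p <> q;
  exch_disc_unit : forall p, D p -> 0 <= p < 1;
  exch_zero : exists2 p, D p & T p = 0;
  exch_sep_gt0 : 0 < s;
  exch_sep : forall n p q, (0 < n)%N -> disc_upto T D n p -> disc_upto T D n q ->
    p < q -> s / n%:R <= q - p;
  exch_sep_left : forall n p, (0 < n)%N -> disc_upto T D n p -> s / n%:R <= p;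
  exch_sep_right : forall n p, (0 < n)%N -> disc_upto T D n p -> s / n%:R <= 1 - p
}.

Section FromKeane.
Context {R : realType} {d : nat} (l : 'I_d -> R) (pi : 'S_d).
Hypothesis d2 : (2 <= d)%N.
Hypothesis l0 : forall i, 0 <= l i.
Hypothesis l1 : \sum_(i < d) l i = 1.
Hypothesis kn : keane l pi.

Let T := iet l pi.
Let D := discont l.

(** For [p = q] the orbit of [p] would be finite, otherwise the orbits of [p] and
    [q] would not be disjoint. *)
Lemma keane_orbit p q k : D p -> D q -> iter k.+1 T p <> q.
Proof.
move=> Dp Dq pq; have [qp|qp] := eqVneq q p; last first.
  move/eqP: qp; apply; apply/esym; have [_ /(_ p q Dp Dq)] := kn; apply.
  by exists q; split; [exists k.+1|exists 0%N].
have [/(_ p Dp) + _] := kn; apply; rewrite qp in pq.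
apply: (@sub_finite_set _ _ ((fun n => iter n T p) @` `I_k.+1)); last first.
  exact/finite_image/finite_II.
move=> _ [n _ <-]; exists (n %% k.+1)%N; first by rewrite /= ltn_mod.
rewrite /= [in RHS](divn_eq n k.+1) addnC iterD; congr iter.
by rewrite iterM iter_fix.
Qed.

Lemma iet1 : T 1 = 1.
Proof.
rewrite /T /iet big_pred0 ?addr0// => j; apply/negP => j1.
suff : 0 <= (1 : R) < 1 by rewrite ltxx andbF.
by apply: (cell_unit l l0 l1 j); rewrite /cell/= in_itv.
Qed.

(** The point 1 is fixed, hence has a finite orbit and cannot be a discontinuity,
    even when the last lengths vanish. *)
Lemma discont_unit p : D p -> 0 <= p < 1.
Proof.
move=> Dp; have p1 : p != 1.
  by apply/eqP => p1; apply: (keane_orbit p p 0 Dp Dp); rewrite /= p1 iet1.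
move: (Dp) => [r /andP[_ /ltnW rd] rp]; rewrite lt_neqAle p1/= -rp.
rewrite -(left_end_all l l1) -(left_end0 l).
by apply/andP; split; apply: left_end_le.
Qed.

Lemma discont_left_end (j : 'I_d) : (0 < j)%N -> D (left_end l j).
Proof. by move=> j0; exists j => //=; rewrite j0 ltn_ord. Qed.

(** If 0 were fixed, so would be the whole first cell, and the right end of this
    cell, a discontinuity, would be the image of the left end of another cell,
    again a discontinuity. *)
Lemma iet0_neq0 : T 0 <> 0.
Proof.
move=> T00.
have [j0 j00] : exists j, cell l j 0 by apply: (cell_cover _ l1); rewrite lexx ltr01.
have j0E : j0 = 0%N :> nat.
  apply/eqP; rewrite -leqn0 leqNgt; apply/negP => jpos.
  have Dj := discont_left_end _ jpos.
  have j00' : left_end l j0 = 0.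
    apply/eqP; rewrite eq_le; have [-> _] := left_end_itv l l0 l1 j0.
    by move: j00; rewrite /cell/= in_itv/= => /andP[->].
  by apply: (keane_orbit _ _ 0 Dj Dj); rewrite /= j00' T00.
(* the first cell is fixed pointwise; its right end is hit by a discontinuity *)
have le0 : left_end l j0 = 0 by rewrite j0E left_end0.
have fix0 x : cell l j0 x -> T x = x.
  move=> xj; have := T00; rewrite /T (iet_cell l pi l0 _ _ j00) (iet_cell l pi l0 _ _ xj).
  lra.
have Dc : D (l j0).
  by exists 1%N; [exact: d2|rewrite -j0E left_endS le0 add0r].
have [q [q01 qc]] := iet_surj l pi l0 l1 _ (discont_unit _ Dc).
have [k qk] := cell_cover _ l1 _ q01.
have kj0 : k != j0.
  apply/eqP => kj; rewrite kj in qk; have := fix0 _ qk; rewrite /T qc.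
  by move: qk; rewrite /cell/= in_itv/= le0; lra.
have kpos : (0 < k)%N.
  by rewrite lt0n; apply: contraNneq kj0 => k0; apply/eqP/val_inj; rewrite /= k0 j0E.
have [qD|qk'] := eqVneq q (left_end l k).
  by apply: (keane_orbit _ _ 0 (discont_left_end _ kpos) Dc); rewrite /= -qD.
have kk : cell l k (left_end l k).
  by move: qk; rewrite /cell/= !in_itv/=; lra.
have Tk : cell l j0 (T (left_end l k)).
  have := iet_unit l pi l0 l1 _ (cell_unit _ l0 l1 _ _ kk).
  rewrite -/T /cell/= in_itv/= le0 add0r => /andP[->/= _].
  rewrite -qc /T (iet_cell l pi l0 _ _ kk) (iet_cell l pi l0 _ _ qk).
  by move: qk qk'; rewrite /cell/= in_itv/= eq_sym neq_lt; lra.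
have := iet_inj l pi l0 l1 _ _ (cell_unit _ l0 l1 _ _ Tk) (cell_unit _ l0 l1 _ _ kk) (fix0 _ Tk).
move=> TkE; rewrite TkE in Tk.
by move/eqP: kj0; apply; exact: (cell_uniq l l0 _ _ _ kk Tk).
Qed.

(** Since 0 is not fixed, its preimage is the left end of a cell other than the
    first one.  To the right of it, [T] is a translation. *)
Lemma zero_preimage : exists p e, [/\ D p, 0 < e, p + e <= 1 &
  forall y, 0 <= y < e -> T (p + y) = y].
Proof.
have [|x [x01 Tx]] := iet_surj l pi l0 l1 0; first by rewrite lexx ltr01.
have [j xj] := cell_cover _ l1 _ x01.
have := iet_cell l pi l0 _ _ xj; rewrite Tx => sj.
have [s0 _] := left_end_itv (image_length l pi) (fun i => l0 _)
  (sum_image_length l pi l1) (pi j).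
move: (xj); rewrite /cell/= in_itv/= => xj'.
have xE : x = left_end l j by lra.
have sE : left_end (image_length l pi) (pi j) = 0 by lra.
exists x, (l j); split; [|lra| |].
- rewrite xE; apply: discont_left_end; rewrite lt0n; apply/eqP => j0.
  by apply: iet0_neq0; move: Tx; rewrite xE j0 left_end0.
- by rewrite xE; have [] := left_end_itv l l0 l1 j.
- move=> y yl; rewrite /T (iet_cell l pi l0 j) ?sE; last by rewrite /cell/= in_itv/=; lra.
  by rewrite -xE; lra.
Qed.

(** The left-hand analogue at 1: the cell whose image ends at 1 ends at a
    discontinuity.  The choice of the cell among those of positive length is
    what makes its image end at 1. *)
Lemma one_preimage : exists q e, [/\ D q, 0 < e, e <= q &
  forall y, 0 < y <= e -> T (q - y) = 1 - y].
Proof.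
have [i0 i0gt] : exists i, 0 < l i.
  apply: contrapT => /forallNP h; have := l1; rewrite big1; first by lra.
  move=> i _; apply/eqP; rewrite eq_le l0 andbT leNgt; exact/negP.
pose k := [arg max_(i > i0 | (0 < l i)%R) (pi i : nat)]%N.
have [kgt kmax] : 0 < l k /\ forall i, 0 < l i -> (pi i <= pi k)%N.
  by rewrite /k; case: arg_maxnP => // i lgt h; split.
have [a0 a1] := left_end_itv l l0 l1 k.
have im1 : left_end (image_length l pi) (pi k) + l k = 1.
  rewrite -image_left_end -l1 [RHS](bigID (fun i => (pi i < pi k)%N))/=; congr (_ + _).
  rewrite (bigD1 k) ?ltnn//= big1 ?addr0// => i /andP[ik ki].
  apply/eqP; rewrite eq_le l0 andbT leNgt; apply: contra ki => /kmax h.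
  by apply/eqP/(@perm_inj _ pi)/val_inj/eqP; rewrite /= eqn_leq h/= leqNgt.
have onk y : 0 < y <= l k -> T (left_end l k.+1 - y) = 1 - y.
  move=> yk; rewrite /T left_endS (iet_cell l pi l0 k); first by lra.
  by rewrite /cell/= in_itv/=; lra.
exists (left_end l k.+1), (l k); split => //; last by rewrite left_endS; lra.
exists k.+1 => //=; case: (ltngtP k.+1 d) => // [dk|kd].
  by have := ltn_ord k; lia.
exfalso; have kk : (0 < k)%N by lia.
have Dk := discont_left_end _ kk.
apply: (keane_orbit _ _ 0 Dk Dk) => /=.
have := onk (l k); rewrite left_endS addrK kgt lexx => -> //.
have : left_end l k.+1 = 1 by rewrite kd left_end_all.
by rewrite left_endS; lra.
Qed.

Lemma discont_iterE n p : disc_upto T D n p -> discont_iter l pi n p.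
Proof. by move=> [p01 [i il Di]]; exists i => //; split => //=; rewrite in_itv. Qed.

Lemma min_gap_sep s n p q : 0 < s -> (0 < n)%N -> ((s / n%:R)%:E < min_gap l pi n)%E ->
  disc_upto T D n p -> disc_upto T D n q -> p < q -> s / n%:R < q - p.
Proof.
move=> s0 n0 + /discont_iterE pn /discont_iterE qn pq.
rewrite /min_gap; case: ifP => _.
  by rewrite lte_fin ltNge divr_ge0// ltW.
move=> /lt_le_trans h; rewrite -lte_fin; apply: h; apply: ereal_inf_lbound.
exists p, q; split => //; first by move=> pq'; move: pq; rewrite pq' ltxx.
by rewrite distrC gtr0_norm// subr_gt0.
Qed.

(** A point of discontinuity [e] of [T^n] that is close to 0 is pulled back to
    [p + e], where [p] is the discontinuity sent to 0, and both are
    discontinuities of [T^(n+1)]; their distance is [e].  The same argument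
    works at 1. *)
Lemma keane_exchange : (exists sigma : R, 0 < sigma /\
     forall n : nat, (0 < n)%N -> ((sigma / n%:R)%:E < min_gap l pi n)%E) ->
  exists s, separated_exchange T D s.
Proof.
move=> [s [s0 gap]].
have [p [dp [Dp dp0 dp1 pT]]] := zero_preimage.
have [q [dq [Dq dq0 dq1 qT]]] := one_preimage.
have p01 := discont_unit _ Dp; have q01 := discont_unit _ Dq.
have [sep1 sep2] : s / 2 <= s /\ 0 < s / 2 by lra.
(* half of [s] pays for replacing the rank [n] by [n + 1] in [s / n] *)
pose t := Num.min (s / 2) (Num.min dp dq).
have ts : t <= s / 2 by rewrite /t ge_min lexx.
have tp : t <= dp by rewrite /t !ge_min lexx orbT.
have tq : t <= dq by rewrite /t !ge_min lexx !orbT.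
have t0 : 0 < t by rewrite /t !lt_min sep2 dp0 dq0.
have tn n : (0 < n)%N -> t / n%:R <= t.
  by move=> n0; rewrite ler_pdivrMr ?ltr0n// ler_peMr ?ler1n// ltW.
have tn1 n : (0 < n)%N -> t / n%:R <= s / n.+1%:R.
  move=> n0; rewrite ler_pdivrMr ?ltr0n// mulrAC ler_pdivlMr ?ltr0n//.
  have n1 : 1 <= n%:R :> R by rewrite ler1n.
  apply: (@le_trans _ _ (s / 2 * (2 * n%:R))); last by lra.
  by apply: ler_pM; rewrite ?ler0n ?(ltW t0)// -natr1; lra.
exists t; split => //.
- exact: iet_unit.
- exact: iet_surj.
- exact: measurable_iet.
- exact: umeas_iet.
- exact: iet_transl.
- by move=> *; exact: keane_orbit.
- exact: discont_unit.
- by exists p => //; have := pT 0; rewrite addr0 lexx dp0; apply.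
- move=> n x y n0 xn yn xy; apply: (le_trans _ (ltW (min_gap_sep _ _ _ _ s0 n0 (gap n n0) xn yn xy))).
  by rewrite ler_pM2r ?invr_gt0 ?ltr0n//; lra.
- move=> n e n0 [e01 [i il De]]; have [ep|ep] := leP dp e.
    by apply: (le_trans (tn n n0)); lra.
  have e0 : 0 < e.
    rewrite lt_neqAle; move/andP: e01 => [-> _]; rewrite andbT; apply/eqP => e0.
    have T0 : T p = 0 by have := pT 0; rewrite addr0 lexx dp0; apply.
    by apply: (keane_orbit p (iter i T e) i Dp De); rewrite iterSr T0 e0.
  apply: (le_trans (tn1 n n0)).
  have -> : e = (p + e) - p by lra.
  apply/ltW; apply: (min_gap_sep _ _ _ _ s0 (ltn0Sn n) (gap n.+1 isT)); last by lra.
    by split => //; exists 0%N.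
  split; first by lra.
  by exists i.+1; rewrite // iterSr pT//; lra.
- move=> n e n0 [e01 [i il De]]; have [ep|ep] := leP dq (1 - e).
    by apply: (le_trans (tn n n0)); lra.
  apply: (le_trans (tn1 n n0)).
  have -> : 1 - e = q - (q - (1 - e)) by lra.
  apply/ltW; apply: (min_gap_sep _ _ _ _ s0 (ltn0Sn n) (gap n.+1 isT)); last by lra.
    split; first by lra.
    exists i.+1; rewrite // iterSr qT; last by lra.
    by rewrite (_ : 1 - (1 - e) = e)//; lra.
  by split => //; exists 0%N.
Qed.

End FromKeane.

(** * Linear recurrence of itineraries *)

Section Exchange.
Context {R : realType} (T : R -> R) (D : set R) (s : R).
Hypothesis H : separated_exchange T D s.

(** Points not separated by a discontinuity of [T^n]; comparing the positions of
    [x] and [y] relative to each discontinuity makes transitivity immediate. *)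
Definition same_itin (n : nat) (x y : R) : Prop :=
  forall p, disc_upto T D n p -> (p <= x) = (p <= y).

Definition clear_itv (n : nat) (a b : R) : Prop :=
  [/\ 0 <= a, b <= 1 & forall p, disc_upto T D n p -> ~ a < p < b].

Lemma same_itin_sym n x y : same_itin n x y -> same_itin n y x.
Proof. by move=> h p /h. Qed.

Lemma same_itin_trans n y x z : same_itin n x y -> same_itin n y z -> same_itin n x z.
Proof. by move=> h1 h2 p np; rewrite h1// h2. Qed.

Lemma disc_upto_le m n p : (m <= n)%N -> disc_upto T D m p -> disc_upto T D n p.
Proof. by move=> mn [p01 [i im Di]]; split => //; exists i => //; exact: leq_trans mn. Qed.

Lemma same_itin_le m n x y : (m <= n)%N -> same_itin n x y -> same_itin m x y.
Proof. by move=> mn h p /(disc_upto_le _ _ _ mn)/h. Qed.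

Lemma clear_same n a b x y : clear_itv n a b -> a <= x < b -> a <= y < b -> same_itin n x y.
Proof.
move=> [_ _ h] xab yab p /h ab; apply/idP/idP => px; apply: contrapT => /negP;
  rewrite -ltNge => py; apply: ab; lra.
Qed.

Lemma iter_unit i x : 0 <= x < 1 -> 0 <= iter i T x < 1.
Proof. by move=> x01; elim: i => //= i; apply: (exch_unit _ _ _ H). Qed.

Lemma iter_surj i y : 0 <= y < 1 -> exists x, 0 <= x < 1 /\ iter i T x = y.
Proof.
elim: i y => [|i ih] y y01; first by exists y.
have [z [z01 <-]] := exch_surj _ _ _ H _ y01.
by have [x [x01 <-]] := ih z z01; exists x.
Qed.

Lemma measurable_iter i (A : set R) : measurable A -> measurable (iter i T @^-1` A).
Proof.
move=> mA; elim: i => [|i ih] //.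
have -> : iter i.+1 T @^-1` A = T @^-1` (iter i T @^-1` A).
  by apply/seteqP; split => x /=; rewrite -iterSr.
exact: (exch_measurable _ _ _ H).
Qed.

Lemma umeas_iter i (A : set R) : measurable A -> umeas (iter i T @^-1` A) = umeas A.
Proof.
move=> mA; elim: i => [|i ih] //.
have -> : iter i.+1 T @^-1` A = T @^-1` (iter i T @^-1` A).
  by apply/seteqP; split => x /=; rewrite -iterSr.
by rewrite (exch_umeas _ _ _ H)//; exact: measurable_iter.
Qed.

Let sep_gt0 n : (0 < n)%N -> 0 < s / n%:R.
Proof. by move=> n0; rewrite divr_gt0 ?ltr0n// (exch_sep_gt0 _ _ _ H). Qed.

(** An interval of length exactly [s / n] is found next to the nearest
    discontinuity at the right of [x], if one is close, and at [x] otherwise. *)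
Lemma clear_around n x : (0 < n)%N -> 0 <= x < 1 ->
  exists a, a <= x < a + s / n%:R /\ clear_itv n a (a + s / n%:R).
Proof.
move=> n0 x01; have := sep_gt0 _ n0; set r := s / n%:R => r0.
have [[e [en xe]]|h] := pselect (exists e, disc_upto T D n e /\ x < e < x + r).
  have [eL eR] := (exch_sep_left _ _ _ H _ _ n0 en, exch_sep_right _ _ _ H _ _ n0 en).
  exists (e - r); split; first by lra.
  split; [by rewrite subr_ge0|by move: eR; rewrite -/r; lra|].
  by move=> p pn pe; have := exch_sep _ _ _ H _ _ _ n0 pn en; rewrite -/r; lra.
have [x1|x1] := leP (x + r) 1.
  exists x; split; first by lra.
  by split => //; [lra|move=> p pn xp; apply: h; exists p].
exists (1 - r); split; first by lra.
have [p Dp _] := exch_zero _ _ _ H.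
have pn : disc_upto T D n p.
  by split; [exact: (exch_disc_unit _ _ _ H)|exists 0%N].
have [pL pR] := (exch_sep_left _ _ _ H _ _ n0 pn, exch_sep_right _ _ _ H _ _ n0 pn).
have p01 := exch_disc_unit _ _ _ H _ Dp.
split; [by move: pL pR; rewrite -/r; lra|by lra|].
by move=> y yn y1; have := exch_sep_right _ _ _ H _ _ n0 yn; rewrite -/r; lra.
Qed.

Lemma clear_around_interior n q : (0 < n)%N -> 0 < q < 1 -> ~ disc_upto T D n q ->
  exists a b, a < q < b /\ clear_itv n a b.
Proof.
move=> n0 q01 nq; have := sep_gt0 _ n0; set r := s / n%:R => r0.
have q01' : 0 <= q < 1 by lra.
have [a [aq ca]] := clear_around n q n0 q01'.
have [aq'|aq'] := ltP a q; first by exists a, (a + r); split => //; rewrite -/r in aq; lra.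
have {}aq' : a = q by lra.
rewrite aq' -/r in ca aq.
have [[e [en eq]]|h] := pselect (exists e, disc_upto T D n e /\ q - r < e < q).
  have eR := exch_sep_right _ _ _ H _ _ n0 en.
  exists e, (e + r); split; first by lra.
  split; [by case: en => /andP[]|by move: eR; rewrite -/r; lra|].
  by move=> p pn pe; have := exch_sep _ _ _ H _ _ _ n0 en pn; rewrite -/r; lra.
have [_ qr1 cq] := ca.
exists (Num.max 0 (q - r)), (q + r); split.
  by rewrite gt_max; lra.
split => //; first by rewrite le_max lexx.
move=> p pn; rewrite gt_max -andbA => /and3P[p0 qp pq].
have [pq'|pq'|pq'] := ltgtP p q; [by apply: h; exists p; split => //; lra| |by apply: nq; rewrite -pq'].
by apply: (cq p pn); lra.
Qed.

(** [T^i] acts on an interval of continuity of [T^n] as one translation, whose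
    image is an interval of continuity of [T^(n-i)]. *)
Lemma clear_iter n a b i : (i <= n)%N -> a < b -> clear_itv n a b ->
  (forall x, a <= x < b -> iter i T x - x = iter i T a - a) /\
  clear_itv (n - i) (iter i T a) (iter i T a + (b - a)).
Proof.
move=> + ab cab; have [a0 b1 nab] := cab; elim: i => [_|i ih lin].
  rewrite /= subn0; split; first by move=> x _; lra.
  by rewrite (_ : a + _ = b)//; lra.
have [h [ta0 tb1 tab]] := ih (ltnW lin).
have h1 x : a <= x < b -> iter i.+1 T x - x = iter i.+1 T a - a.
  move=> xab; have /= := exch_transl _ _ _ H _ _ ta0 tb1 _ (iter i T x).
  have := h x xab => hx hh.
  suff : T (iter i T x) - iter i T x = T (iter i T a) - iter i T a by rewrite /=; lra.
  apply: hh; last by lra.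
  move=> p Dp; apply: tab; split; first exact: (exch_disc_unit _ _ _ H).
  by exists 0%N => //; rewrite subn_gt0.
split => //; split.
- by have /andP[] : 0 <= iter i.+1 T a < 1 by apply: iter_unit; lra.
- rewrite leNgt; apply/negP => t1.
  pose x := Num.max a (1 - iter i.+1 T a + a).
  have xab : a <= x < b by rewrite /x le_max lexx andTb gt_max; apply/andP; split; lra.
  have xt : 1 - iter i.+1 T a + a <= x by rewrite /x le_max lexx orbT.
  have := h1 x xab; have := iter_unit i.+1 x; lra.
- move=> p [p01 [j jn Dj]] pab; pose q := p - (iter i.+1 T a - a).
  have qab : a <= q < b by rewrite /q; lra.
  have qp : iter i.+1 T q = p by have := h1 q qab; rewrite {2}/q; lra.
  apply: (nab q); last by rewrite /q; lra.
  split; first by lra.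
  exists (j + i.+1)%N; first by clear -jn; lia.
  by rewrite iterD qp.
Qed.

Lemma same_clear n x y : (0 < n)%N -> 0 <= x -> x <= y -> y < 1 -> same_itin n x y ->
  exists2 b, y < b & clear_itv n x b.
Proof.
move=> n0 x0 xy y1 sxy.
have [|a [ya [a0 a1 ca]]] := clear_around n y n0; first by lra.
exists (a + s / n%:R); first by lra.
split => // p pn pab; have [py|py] := leP p y.
  by move: (sxy p pn); rewrite py => px; move: pab; rewrite ltNge px.
by apply: (ca p pn); lra.
Qed.

Lemma same_itin_iter n i x y : (0 < n)%N -> (i <= n)%N ->
  0 <= x < 1 -> 0 <= y < 1 -> same_itin n x y ->
  same_itin (n - i) (iter i T x) (iter i T y).
Proof.
move=> n0 il x01 y01 sxy; wlog xy : x y x01 y01 sxy / x <= y.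
  move=> h; have [xy|/ltW yx] := leP x y; first exact: h.
  by apply/same_itin_sym/h => //; exact: same_itin_sym.
have [||||b yb cb] := same_clear n x y n0 => //; [lra|lra|].
have xb : x < b by lra.
have [h c] := clear_iter _ _ _ _ il xb cb.
have hy := h y; apply: (clear_same _ _ _ _ _ c); lra.
Qed.

Lemma sum_indic_disjoint n (A : 'I_n -> set R) x :
  (forall i j, A i x -> A j x -> i = j) -> \sum_(i < n) \1_(A i) x <= 1 :> R.
Proof.
move=> dA; have [[i Ai]|h] := pselect (exists i, A i x); last first.
  rewrite big1// => i _; rewrite indicE memNset// => Ai; apply: h; by exists i.
rewrite (bigD1 i)//= big1 ?addr0 => [|j ji]; first by rewrite indicE; case: (_ \in _).
by rewrite indicE memNset// => Aj; move: ji; rewrite (dA _ _ Ai Aj) eqxx.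
Qed.

(** Quantitative Poincare recurrence: preimages of [[a, b[] under [K] iterates
    have total measure more than 1, so two of them meet. *)
Lemma recurrence K a b : 0 <= a -> a <= b -> b <= 1 -> 1 < K%:R * (b - a) ->
  exists k x, [/\ (0 < k < K)%N, a <= x < b & a <= iter k T x < b].
Proof.
move=> a0 ab b1 Kab; apply: contrapT => h.
have mab : measurable (`[a, b[%classic : set R) by exact: measurable_itv.
have := @umeas_sum_le R 'I_K (index_enum 'I_K) 1 (fun i => iter i T @^-1` `[a, b[%classic)
  (fun i => measurable_iter i _ mab).
under eq_bigr do rewrite umeas_iter// umeas_itv//.
rewrite sumr_const card_ord -mulr_natl => h'.
suff : K%:R * (b - a) <= 1 by lra.
apply: h' => x _; apply: sum_indic_disjoint => i j.
suff hh (i' j' : 'I_K) : a <= iter i' T x < b -> a <= iter j' T x < b -> (i' < j')%N -> False.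
  rewrite /= !in_itv/= => xi xj; apply/val_inj => /=; case: (ltngtP i j) => // ij.
  - by case: (hh i j).
  - by case: (hh j i).
move=> xi xj ij; apply: h; exists (j' - i')%N, (iter i' T x); split => //.
  by rewrite subn_gt0 ij/= (leq_ltn_trans (leq_subr _ _)).
by rewrite -iterD subnK// ltnW.
Qed.

Lemma harmonic_blocks C n : (0 < n)%N ->
  \sum_(0 <= c < C) c.+2%:R^-1 <= \sum_(0 <= j < C * n) (n + j)%:R^-1 :> R.
Proof.
move=> n0; elim: C => [|C ih]; first by rewrite mul0n !big_geq.
rewrite big_nat_recr//= mulSnr (big_cat_nat (leq0n _) (leq_addr n (C * n)))/=.
apply: lerD => //.
apply: (@le_trans _ _ (\sum_(C * n <= j < C * n + n) (C.+2 * n)%:R^-1)).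
  rewrite sumr_const_nat addKn -[leRHS]mulr_natr natrM invfM divfK//.
  by rewrite pnatr_eq0 -lt0n.
rewrite big_seq [leRHS]big_seq; apply: ler_sum => j; rewrite mem_index_iota => hj.
rewrite lef_pV2 ?posrE ?ltr0n ?muln_gt0 ?n0 ?addn_gt0 ?n0// ler_nat.
by rewrite !mulSn; lia.
Qed.

Lemma harmonic_large (M : R) : exists C, M < \sum_(0 <= c < C) c.+2%:R^-1.
Proof.
apply: contrapT => /forallNP h; apply: (@dvg_harmonic R).
apply: nondecreasing_is_cvgn.
  apply/nondecreasing_seqP => n; rewrite /series/= big_nat_recr//= lerDl.
  exact: harmonic_ge0.
exists (1 + M) => _ [n _ <-]; rewrite /series/=.
case: n => [|n]; first by rewrite big_geq//; have /negP := h 0%N; rewrite big_geq// -leNgt; lra.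
rewrite big_nat_recl//= invr1 lerD2l leNgt; exact/negP.
Qed.

Definition hits_class (n : nat) (z x : R) : Prop :=
  exists i, same_itin n (iter i T x) z.

Definition first_hit (n : nat) (z x : R) (i : nat) : Prop :=
  same_itin n (iter i T x) z /\ forall j, (j < i)%N -> ~ same_itin n (iter j T x) z.

Lemma first_hit_exists n z x : hits_class n z x -> exists i, first_hit n z x i.
Proof.
move=> [i0 h0].
have ex : exists i, `[< same_itin n (iter i T x) z >] by exists i0; exact/asboolP.
case: (ex_minnP ex) => i /asboolP hi imin; exists i; split => // j ji /asboolP hj.
by have := imin j hj; rewrite leqNgt ji.
Qed.

Lemma first_hit_iter n z x i j : (j <= i)%N -> first_hit n z x i ->
  first_hit n z (iter (i - j) T x) j.
Proof.
move=> ji [h1 h2]; split; first by rewrite -iterD subnKC.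
by move=> k kj; rewrite -iterD; apply: h2; lia.
Qed.

Lemma same_itin_iter_le n m i x y : (0 < n)%N -> (n + i <= m)%N ->
  0 <= x < 1 -> 0 <= y < 1 -> same_itin m x y ->
  same_itin n (iter i T x) (iter i T y).
Proof.
move=> n0 nim x01 y01 /same_itin_iter h; apply: (same_itin_le n (m - i)).
  by rewrite leq_subRL ?(leq_trans (leq_addl n i))// addnC.
by apply: h => //; lia.
Qed.

Lemma first_hit_same n z x y i m : (0 < n)%N -> (n + i <= m)%N ->
  0 <= x < 1 -> 0 <= y < 1 -> same_itin m x y ->
  first_hit n z x i -> first_hit n z y i.
Proof.
move=> n0 nim x01 y01 sxy [h1 h2].
have h j : (j <= i)%N -> same_itin n (iter j T x) (iter j T y).
  by move=> ji; apply: (same_itin_iter_le n m) => //; lia.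
split; first exact: same_itin_trans (same_itin_sym _ _ _ (h i (leqnn _))) h1.
move=> j ji hj; apply: (h2 j ji); exact: same_itin_trans (h j (ltnW ji)) hj.
Qed.

(** The points whose first entrance time is [j] contain an interval of length
    [s / (n + j)] around a point of the orbit of [x], for every [j < N], and
    these intervals are disjoint. *)
Lemma first_hit_sum n z x N : (0 < n)%N -> 0 <= x < 1 -> first_hit n z x N ->
  s * \sum_(0 <= j < N) (n + j)%:R^-1 <= 1.
Proof.
move=> n0 x01 hN.
have h (j : 'I_N) : exists a, [/\ 0 <= a, a + s / (n + j)%:R <= 1 &
    forall y, a <= y < a + s / (n + j)%:R -> first_hit n z y j].
  have nj : (0 < n + j)%N by rewrite addn_gt0 n0.
  have u01 := iter_unit (N - j) x x01.
  have [a [ax ca]] := clear_around (n + j) _ nj u01; have [a0 a1 _] := ca.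
  exists a; split => // y ya; apply: (first_hit_same n z (iter (N - j) T x) y j (n + j)) => //.
  - by lra.
  - exact: clear_same ca ax ya.
  - by apply: first_hit_iter => //; exact: ltnW.
have {h}[a ha] := choice h.
pose A (j : 'I_N) := `[a j, a j + s / (n + j)%:R[%classic : set R.
have := @umeas_sum_le R 'I_N (index_enum 'I_N) 1 A (fun j => measurable_itv _).
rewrite big_mkord mulr_sumr => h'.
have -> : \sum_(i < N) s * (n + i)%:R^-1 = \sum_(i < N) umeas (A i).
  apply: eq_bigr => j _; have [a0 a1 _] := ha j.
  have nj : (0 < n + j)%N by rewrite addn_gt0 n0.
  rewrite umeas_itv//; first by rewrite addrAC subrr add0r.
  by rewrite lerDl ltW// sep_gt0.
apply: h' => y _; apply: sum_indic_disjoint => i j; rewrite /A/= !in_itv/= => yi yj.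
have [_ _ /(_ y yi) [hi1 hi2]] := ha i; have [_ _ /(_ y yj) [hj1 hj2]] := ha j.
apply/val_inj => /=; case: (ltngtP i j) => // ij.
- by case: (hj2 i ij).
- by case: (hi2 j ij).
Qed.

Lemma first_hit_bound : exists2 C, (0 < C)%N & forall n z x i,
  (0 < n)%N -> 0 <= x < 1 -> first_hit n z x i -> (i < C * n)%N.
Proof.
have [C hC] := harmonic_large (1 / s); have s0 := exch_sep_gt0 _ _ _ H.
exists C.
  case: C hC => // ; rewrite big_geq// => h; have : 0 < 1 / s by rewrite divr_gt0.
  lra.
move=> n z x i n0 x01 hi; rewrite ltnNge; apply/negP => Ci.
have := first_hit_iter _ _ _ _ _ Ci hi => /(first_hit_sum _ _ _ _ n0 (iter_unit _ _ x01)).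
rewrite leNgt => /negP; apply; rewrite mulrC -ltr_pdivrMr//.
exact: lt_le_trans (harmonic_blocks C n n0).
Qed.

(** One-sided, since classes of itineraries are closed on the left: a change of
    [P] always shows at the left end of a class. *)
Definition left_boundary (P : R -> Prop) (p : R) : Prop :=
  0 < p < 1 /\ forall e, 0 < e -> exists y, [/\ 0 <= y, p - e < y, y < p & ~ (P y <-> P p)].

Lemma left_boundary_exists (m : nat) (P : R -> Prop) u v : (0 < m)%N ->
  (forall x y, 0 <= x < 1 -> 0 <= y < 1 -> same_itin m x y -> P x -> P y) ->
  0 <= u -> u < v -> v < 1 -> ~ (P u <-> P v) -> exists p, left_boundary P p.
Proof.
move=> m0 satP u0 uv v1 Puv.
pose A := [set y | u <= y <= v /\ (P y <-> P u)].
have Au : A u by split; [lra|].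
have supA : has_sup A by split; [exists u|exists v => y [/andP[]]].
have [us sv] : u <= sup A /\ sup A <= v.
  split; first exact: ub_le_sup supA.2 _ Au.
  by apply: ge_sup => //; [exists u|move=> y [/andP[]]].
have [Ps|Ps] := pselect (P (sup A) <-> P u); last first.
  have us' : u < sup A.
    by rewrite lt_neqAle us andbT; apply/eqP => ue; apply: Ps; rewrite -ue.
  exists (sup A); split; first by lra.
  move=> e e0; have [y Ay yA] := sup_adherent e0 supA.
  have [yuv Py] := Ay; exists y; split => //; [by lra| |by tauto].
  rewrite lt_neqAle (ub_le_sup supA.2 Ay) andbT.
  by apply/eqP => yE; apply: Ps; rewrite -yE.
have sv' : sup A < v.
  rewrite lt_neqAle sv andbT; apply/eqP => sE; apply: Puv; rewrite -sE; tauto.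
have s01 : 0 <= sup A < 1 by lra.
have [a [sa ca]] := clear_around m _ m0 s01; have [a0 a1 _] := ca.
pose w := Num.min v (a + s / m%:R).
have [sw wv wa] : [/\ sup A < w, w <= v & w <= a + s / m%:R].
  by split; rewrite /w ?lt_min ?ge_min ?lexx ?orbT//; apply/andP; split; lra.
pose y := (sup A + w) / 2.
have [sy yw] : sup A < y /\ y < w by rewrite /y; split; lra.
have y01 : 0 <= y < 1 by lra.
have ssy : same_itin m (sup A) y by apply: (clear_same _ _ _ _ _ ca); lra.
have Py : P y <-> P (sup A).
  split; first exact: satP y01 s01 (same_itin_sym _ _ _ ssy).
  exact: satP s01 y01 ssy.
have Ay : A y by split; [lra|tauto].
by have := ub_le_sup supA.2 Ay; rewrite leNgt sy.
Qed.

Lemma left_boundary_disc m P p : (0 < m)%N ->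
  (forall x y, 0 <= x < 1 -> 0 <= y < 1 -> same_itin m x y -> P x -> P y) ->
  left_boundary P p -> disc_upto T D m p.
Proof.
move=> m0 satP [p01 hp]; apply: contrapT => np.
have [a [b [pab cab]]] := clear_around_interior m p m0 p01 np.
have pa0 : 0 < p - a by lra.
have [y [y0 py yp nPy]] := hp _ pa0; apply: nPy.
have sy : same_itin m y p by apply: (clear_same _ _ _ _ _ cab); lra.
split; first by apply: satP => //; lra.
by apply: satP; [lra|lra|exact: same_itin_sym].
Qed.

Lemma disc_not_iter_disc p q k m : (0 < k)%N -> disc_upto T D m q ->
  iter (k + m) T q = p -> ~ D p.
Proof.
move=> k0 [q01 [i im Di]] qp Dp.
apply: (exch_orbit _ _ _ H _ _ (k + m - i).-1 Di Dp).
have e : ((k + m - i).-1.+1 + i = k + m)%N by clear - k0 im; lia.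
by rewrite -iterD e.
Qed.

(** The preimage [q] of a boundary point is neither a discontinuity nor 0:
    by [left_boundary_disc] the orbit of [p] reaches a discontinuity, which the
    orbit of a discontinuity never does, and 0 is itself the image of a
    discontinuity.  Near [q], [T] is then a translation. *)
Lemma left_boundary_preimage m P p : (0 < m)%N ->
  (forall x y, 0 <= x < 1 -> 0 <= y < 1 -> same_itin m x y -> P x -> P y) ->
  (forall x, 0 <= x < 1 -> P (T x) <-> P x) ->
  left_boundary P p -> exists2 q, left_boundary P q & T q = p.
Proof.
move=> m0 satP invP bp; have [p01 hp] := bp.
have [p01' [i im Di]] := left_boundary_disc m P p m0 satP bp.
have [q [q01 qp]] := exch_surj _ _ _ H p p01'.
have nDq : ~ D q.
  by move=> Dq; apply: (exch_orbit _ _ _ H _ _ i Dq Di); rewrite iterSr qp.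
have q0 : q != 0.
  apply/eqP => q0; have [z Dz Tz] := exch_zero _ _ _ H.
  by apply: (exch_orbit _ _ _ H _ _ i.+1 Dz Di); rewrite !iterSr Tz -q0 qp.
have q01s : 0 < q < 1 by rewrite lt_neqAle eq_sym q0.
have nq1 : ~ disc_upto T D 1 q.
  by move=> [_ [[|j]//= _ Dq]]; exact: nDq.
have [a [b [qab cab]]] := clear_around_interior 1 q (ltn0Sn 0) q01s nq1.
have ab : a < b by lra.
have [trans _] := clear_iter _ _ _ _ (leqnn 1) ab cab; have [a0 b1 _] := cab.
exists q => //; split => // e e0.
have e1 : 0 < Num.min e (q - a) by rewrite lt_min e0; lra.
have [y [y0 py yp Pyp]] := hp _ e1.
have [ye ya] : p - e < y /\ p - (q - a) < y.
  by split; apply: le_lt_trans py; rewrite lerD2l lerN2 ge_min lexx ?orbT.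
have Tz : T (q - (p - y)) = y.
  have h1 := trans q; have h2 := trans (q - (p - y)).
  by rewrite /= in h1 h2; lra.
have zq : 0 <= q - (p - y) < 1 by lra.
exists (q - (p - y)); split; [lra|lra|lra|].
by have := invP _ zq; have := invP _ q01; rewrite Tz qp; tauto.
Qed.

(** Pulling a boundary point [p] back [m + 1] times gives a boundary point
    again, which reaches a discontinuity in less than [m] steps; the orbit then
    goes through [p] and on to a second discontinuity, against the Keane
    condition. *)
Lemma invariant_trivial m P : (0 < m)%N ->
  (forall x y, 0 <= x < 1 -> 0 <= y < 1 -> same_itin m x y -> P x -> P y) ->
  (forall x, 0 <= x < 1 -> P (T x) <-> P x) ->
  forall x y, 0 <= x < 1 -> 0 <= y < 1 -> P x -> P y.
Proof.
move=> m0 satP invP.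
have nob p : ~ left_boundary P p.
  move=> bp; have [p01' [i im Di]] := left_boundary_disc m P p m0 satP bp.
  have [q bq qp] : exists2 q, left_boundary P q & iter m.+1 T q = p.
    move: (m.+1) => k; elim: k => [|k [q bq qp]]; first by exists p.
    have [z bz zq] := left_boundary_preimage m P q m0 satP invP bq.
    by exists z; rewrite // iterSr zq.
  have qm : disc_upto T D m q by exact: left_boundary_disc bq.
  apply: (disc_not_iter_disc _ q i.+1 m (ltn0Sn i) qm _ Di).
  by rewrite -qp -iterD addnS addSn.
move=> x y x01 y01 Px; apply: contrapT => nPy.
have [xy|xy|xy] := ltgtP x y; last by apply: nPy; rewrite -xy.
- have [||||p bp] := left_boundary_exists m P x y m0 satP => //; [lra|lra|tauto|].
  exact: nob bp.
- have [||||p bp] := left_boundary_exists m P y x m0 satP => //; [lra|lra|tauto|].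
  exact: nob bp.
Qed.

(** Linear recurrence.  If some orbit missed the class of [z], the set of points
    whose orbit meets it would be a nontrivial union of classes; this set is
    invariant, since a recurrent point that enters the class enters it again. *)
Theorem visits_every_class : exists2 C, (0 < C)%N & forall n z x, (0 < n)%N ->
  0 <= z < 1 -> 0 <= x < 1 -> exists2 i, (i <= C * n)%N & same_itin n (iter i T x) z.
Proof.
have [C C0 hC] := first_hit_bound; exists C => // n z x n0 z01 x01.
suff : hits_class n z x.
  move=> /first_hit_exists[i hi]; exists i; last by case: hi.
  exact: ltnW (hC _ _ _ _ n0 x01 hi).
(* whether an orbit meets the class of [z] is decided by its first [C * n]
   steps, so it depends on the itinerary of length [m] only *)
pose m := (n + C * n)%N.
have m0 : (0 < m)%N by rewrite addn_gt0 n0.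
have sat y y' : 0 <= y < 1 -> 0 <= y' < 1 -> same_itin m y y' ->
    hits_class n z y -> hits_class n z y'.
  move=> y01 y01' yy' /first_hit_exists[i hi].
  have im : (n + i <= m)%N by rewrite leq_add2l ltnW// (hC n z y).
  by exists i; have [] := first_hit_same _ _ _ _ _ _ n0 im y01 y01' yy' hi.
apply: (invariant_trivial m (hits_class n z) m0 sat _ z x z01 x01); last first.
  by exists 0%N.
move=> y y01; split=> [[i hi]|hy]; first by exists i.+1; rewrite iterSr.
apply: contrapT => nhTy.
have [a [ya ca]] := clear_around m.+1 y (ltn0Sn m) y01; have [a0 a1 _] := ca.
have r0 := sep_gt0 m.+1 (ltn0Sn m).
have [K hK] : exists K : nat, 1 < K%:R * (s / m.+1%:R).
  exists (Num.truncn ((s / m.+1%:R)^-1)).+1.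
  by rewrite -ltr_pdivrMr// div1r truncnS_gt.
have aa : a <= a + s / m.+1%:R by rewrite lerDl ltW.
have Kaa : 1 < K%:R * (a + s / m.+1%:R - a) by rewrite [a + _]addrC addrK.
have [k [x' [k0 x'a kx']]] := recurrence K a _ a0 aa a1 Kaa.
have inV y' : a <= y' < a + s / m.+1%:R -> hits_class n z y' /\ ~ hits_class n z (T y').
  move=> y'a; have y'01 : 0 <= y' < 1.
    by case/andP: y'a => ay yb; rewrite (le_trans a0 ay)/= (lt_le_trans yb a1).
  have sy : same_itin m.+1 y' y by exact: clear_same ca y'a ya.
  split.
    apply: (sat y) => //; apply: same_itin_le (leqnSn m) _; exact: same_itin_sym.
  move=> h; apply: nhTy; apply: (sat (T y')) => //.
  - exact: (exch_unit _ _ _ H).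
  - exact: (exch_unit _ _ _ H).
  - by apply: (same_itin_iter_le m m.+1 1) => //; rewrite addn1.
have [_] := inV _ x'a; apply; have [[i hi] _] := inV _ kx'.
by exists (i + k.-1)%N; rewrite -iterSr -addnS prednK ?iterD//; case/andP: k0.
Qed.

(** If [x] and [T^k x] have the same long itinerary, the orbit of [x] is
    [k]-periodic at the level of classes of rank [k + 1] and visits at most
    [k] of them; but the [k + 1] points [q j] with [T^j (q j) = p] lie in
    distinct classes, all visited. *)
Lemma no_quick_return C : (forall n z x, (0 < n)%N -> 0 <= z < 1 -> 0 <= x < 1 ->
    exists2 i, (i <= C * n)%N & same_itin n (iter i T x) z) ->
  forall n k x, (0 < k)%N -> (C.+1 * k.+1 <= n)%N -> 0 <= x < 1 ->
  ~ same_itin n x (iter k T x).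
Proof.
move=> hC n k x k0 kn x01 sx.
have [p Dp _] := exch_zero _ _ _ H; have p01 := exch_disc_unit _ _ _ H _ Dp.
have [q hq] := choice (fun j : 'I_k.+1 => iter_surj j _ p01).
have q_inj (j j' : 'I_k.+1) : same_itin k.+1 (q j) (q j') -> j = j'.
  have disq i : disc_upto T D k.+1 (q i).
    by have [q01 qi] := hq i; split => //; exists i; rewrite // qi.
  move=> sq; have qq : q j = q j'.
    apply/eqP; rewrite eq_le -(sq _ (disq j)) lexx/=.
    by rewrite (sq _ (disq j')) lexx.
  suff h (a b : 'I_k.+1) : q a = q b -> (a < b)%N -> False.
    apply/val_inj => /=; case: (ltngtP j j') => // jj.
    - by case: (h j j').
    - by case: (h j' j).
  move=> qab ab; have [_ qa] := hq a; have [_ qb] := hq b.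
  apply: (exch_orbit _ _ _ H p p (b - a).-1 Dp Dp).
  by rewrite prednK ?subn_gt0// -{1}qa -iterD qab subnK// ltnW.
have hit (j : 'I_k.+1) : exists i,
    (i <= C * k.+1)%N /\ same_itin k.+1 (iter i T x) (q j).
  by have [q01 _] := hq j; have [i iC si] := hC _ _ x (ltn0Sn k) q01 x01; exists i.
have [f hf] := choice hit.
have period i : (i <= C * k.+1)%N -> same_itin k.+1 (iter i T x) (iter (i + k) T x).
  move=> iC; rewrite iterD; apply: (same_itin_iter_le _ n) => //; last exact: iter_unit.
  by move: kn; rewrite mulSn; lia.
have modk i : (i <= C * k.+1)%N -> same_itin k.+1 (iter (i %% k) T x) (iter i T x).
  elim/ltn_ind: i => i ih iC; have [ik|ki] := ltnP i k; first by rewrite modn_small.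
  have ikC : (i - k <= C * k.+1)%N by rewrite (leq_trans _ iC)// leq_subr.
  apply: (same_itin_trans _ (iter (i - k) T x)).
    rewrite -{1}(subnK ki) modnDr; apply: ih => //.
    by rewrite ltn_subrL k0 (leq_trans k0 ki).
  by have := period _ ikC; rewrite subnK.
pose g (j : 'I_k.+1) : 'I_k := Ordinal (ltn_pmod (f j) k0).
have : (#|'I_k.+1| <= #|'I_k|)%N.
  apply: (leq_card g) => j j' /(congr1 val)/= ff; apply: q_inj.
  have [fj sj] := hf j; have [fj' sj'] := hf j'.
  apply: same_itin_trans (same_itin_sym _ _ _ sj) _.
  apply: same_itin_trans _ sj'.
  apply: same_itin_trans (same_itin_sym _ _ _ (modk _ fj)) _.
  by rewrite ff; exact: modk.
by rewrite !card_ord ltnn.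
Qed.

(** An interval of continuity of length [L] returns to itself within [1 / L]
    steps, so [no_quick_return] bounds [n] by a multiple of [1 / L]. *)
Theorem class_diameter : exists2 K : R, 0 < K & forall n x y, (0 < n)%N ->
  0 <= x < 1 -> 0 <= y < 1 -> same_itin n x y -> `|x - y| * n%:R <= K.
Proof.
have [C C0 hC] := visits_every_class.
exists (2 * C.+1%:R) => [|n x y n0]; first by rewrite mulr_gt0 ?ltr0n.
wlog xy : x y / y <= x.
  move=> h x01 y01 sxy; have [yx|/ltW xy] := leP y x; first exact: h.
  by rewrite distrC; apply: h => //; exact: same_itin_sym.
move=> x01 y01 sxy; rewrite ger0_norm ?subr_ge0// leNgt; apply/negP => hL.
have [||||b xb cb] := same_clear n y x n0; [lra|lra|lra|exact: same_itin_sym|].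
have [y0 b1 _] := cb; pose L := b - y.
have L0 : 0 < L by rewrite /L; lra.
have nR : 0 < n%:R :> R by rewrite ltr0n.
have hL' : 2 * C.+1%:R < L * n%:R.
  by apply: (lt_trans hL); rewrite ltr_pM2r// /L; lra.
have K1 : 1 < (Num.truncn L^-1).+1%:R * L by rewrite -ltr_pdivrMr// div1r truncnS_gt.
have yb : y <= b by lra.
have [k [z [/andP[k0 kK] za kza]]] := recurrence _ _ _ y0 yb b1 K1.
have kL : k%:R * L <= 1.
  rewrite -ler_pdivlMr// div1r (le_trans (_ : _ <= (Num.truncn L^-1)%:R))//.
    by rewrite ler_nat.
  by rewrite truncn_le invr_ge0 ltW.
apply: (no_quick_return C hC n k z k0 _ _ (clear_same _ _ _ _ _ cb za kza)); last by lra.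
rewrite -(ler_nat R) natrM.
have k1 : k.+1%:R <= 2 * k%:R :> R.
  have k1 : 1 <= k%:R :> R by rewrite ler1n.
  by rewrite -natr1; lra.
apply: (@le_trans _ _ (C.+1%:R * (2 * k%:R))); first by rewrite ler_pM2l ?ltr0n.
rewrite -(ler_pM2l L0); apply: (@le_trans _ _ (2 * C.+1%:R)); last exact: ltW.
rewrite (_ : L * _ = 2 * C.+1%:R * (k%:R * L)); last by ring.
by rewrite ler_piMr// mulr_ge0.
Qed.

End Exchange.

(** * Equidistribution at every scale, with a rate *)

(** All that equidistribution requires of [T] besides measure preservation:
    linear recurrence of itineraries, combined with the shortness of classes. *)
Definition shadowing {R : realType} (T : R -> R) (C : nat) (K : R) : Prop :=
  forall n x z, (0 < n)%N -> 0 <= x < 1 -> 0 <= z < 1 ->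
  exists2 i, (i <= C * n)%N & forall j, (j <= n)%N ->
    `|iter (i + j) T x - iter j T z| * n%:R <= K.

(** Sharing an itinerary of length [2 n] implies sharing itineraries of length
    [n] during [n] steps, hence distances at most [K / n]. *)
Lemma exchange_shadowing {R : realType} (T : R -> R) D s :
  separated_exchange T D s -> exists C K, 0 < K /\ shadowing T C K.
Proof.
move=> H; have [C C0 hC] := visits_every_class T D s H.
have [K K0 hK] := class_diameter T D s H.
exists (C * 2)%N, K; split => // n x z n0 x01 z01.
have [|i iC si] := hC (2 * n)%N z x _ z01 x01; first by rewrite muln_gt0.
exists i; first by rewrite -mulnA.
move=> j jn; apply: hK => //; [exact: (iter_unit T D s H)|exact: (iter_unit T D s H)|].
rewrite addnC iterD; apply: (same_itin_iter_le T D s H n (2 * n)) => //.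
  by rewrite mul2n -addnn leq_add2l.
exact: (iter_unit T D s H).
Qed.

Section Equidistribution.
Context {R : realType} (T : R -> R).
Hypothesis T_unit : forall x, 0 <= x < 1 -> 0 <= T x < 1.
Hypothesis T_measurable : forall i A, measurable A -> measurable (iter i T @^-1` A).
Hypothesis T_umeas : forall i A, measurable A -> umeas (iter i T @^-1` A) = umeas A.
Context (C : nat) (K : R).
Hypothesis K0 : 0 < K.
Hypothesis T_shadow : shadowing T C K.

Definition visits (c rho : R) (w : nat) (x : R) : R :=
  \sum_(0 <= j < w) \1_(ball c rho) (iter j T x).

Lemma iter_T_unit i x : 0 <= x < 1 -> 0 <= iter i T x < 1.
Proof. by move=> x01; elim: i => //= i /T_unit. Qed.

Lemma visitsD c rho a b x :
  visits c rho (a + b) x = visits c rho a x + visits c rho b (iter a T x).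
Proof.
rewrite /visits (big_cat_nat (leq0n a) (leq_addr b a))/=; congr (_ + _).
rewrite -{1}[a]add0n big_addn addKn; apply: eq_bigr => j _.
by rewrite iterD.
Qed.

Lemma indic_le1 (A : set R) x : 0 <= (\1_A x : R) <= 1.
Proof. by rewrite indicE; case: (_ \in _); rewrite ?lexx ?ler01. Qed.

Lemma visits_ge0 c rho w x : 0 <= visits c rho w x.
Proof. by apply: sumr_ge0 => j _; have /andP[] := indic_le1 (ball c rho) (iter j T x). Qed.

Lemma visits_le c rho a b x : (a <= b)%N -> visits c rho a x <= visits c rho b x.
Proof. by move=> /subnKC <-; rewrite visitsD lerDl visits_ge0. Qed.

Lemma umeas_ball_le (c rho : R) : 0 < rho -> umeas (ball c rho) <= 2 * rho.
Proof.
move=> r0; apply: (@le_trans _ _ (umeas `[c - rho, c + rho])).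
  apply: umeas_le; [exact: measurable_ball|exact: measurable_itv|].
  move=> x _; rewrite /ball/= in_itv/= ltr_norml => h; lra.
by apply: le_trans (umeas_itvcc _ _ _) _; lra.
Qed.

(** Integrate over the unit interval: [T] preserves the measure. *)
Lemma visits_mean (c rho : R) w (h : R) : 0 < rho ->
  (forall z, 0 <= z < 1 -> h <= visits c rho w z) -> h <= w%:R * (2 * rho).
Proof.
move=> r0 hz.
have mb : measurable (ball c rho : set R) by exact: measurable_ball.
have := @umeas_sum_ge R nat (index_iota 0 w) h (fun i => iter i T @^-1` ball c rho)
  (fun i => T_measurable i _ mb) hz.
move/le_trans; apply; under eq_bigr do rewrite T_umeas//.
rewrite sumr_const_nat subn0 -[leLHS]mulr_natl ler_wpM2l//.
exact: umeas_ball_le.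
Qed.

Lemma visits_shadow (c rho : R) n (x y : R) : (0 < n)%N -> 0 < rho ->
  (forall j, (j <= n)%N -> `|iter j T x - iter j T y| * n%:R <= K) ->
  visits c rho n x <= visits c (rho + K / n%:R) n y.
Proof.
move=> n0 r0 h; rewrite /visits big_seq [leRHS]big_seq; apply: ler_sum => j.
rewrite mem_index_iota => /andP[_ /ltnW/h].
rewrite -ler_pdivlMr ?ltr0n// => hj.
have [hx|nx] := pselect (ball c rho (iter j T x)); last first.
  rewrite [leLHS]indicE memNset// mulr0n.
rewrite [leLHS]indicE mem_set//; move: hx; rewrite /ball/= => hx; rewrite indicE mem_set// /ball/=.
have := ler_distD (iter j T x) c (iter j T y); lra.
Qed.

Let K1 : R := 2 * K + 1.

Let K1_gt1 : 1 < K1.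
Proof. by have := K0; rewrite /K1; lra. Qed.

Let K1_gt0 : 0 < K1.
Proof. by rewrite (lt_trans _ K1_gt1). Qed.

(** A segment with at most the mean number of visits exists; enlarging the ball
    by [K / w] absorbs the error made in shadowing it, at a bounded cost. *)
Lemma visits_low (c rho : R) w (x : R) : (0 < w)%N -> 0 < rho -> 0 <= x < 1 ->
  exists2 i, (i <= C * w)%N & visits c rho w (iter i T x) <= 2 * rho * w%:R + K1.
Proof.
move=> w0 r0 x01; have wR : 0 < w%:R :> R by rewrite ltr0n.
have r'0 : 0 < rho + K / w%:R by rewrite addr_gt0// divr_gt0.
have [z [z01 hz]] : exists z, 0 <= z < 1 /\
    visits c (rho + K / w%:R) w z <= 2 * rho * w%:R + K1.
  apply: contrapT => /forallNP h.
  have hh z : 0 <= z < 1 -> 2 * rho * w%:R + K1 <= visits c (rho + K / w%:R) w z.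
    move=> z01; rewrite leNgt; apply/negP => hz; apply: (h z).
    by split => //; exact: ltW.
  have := visits_mean c (rho + K / w%:R) w _ r'0 hh.
  have -> : w%:R * (2 * (rho + K / w%:R)) = 2 * rho * w%:R + 2 * K.
    by field; rewrite gt_eqF.
  by rewrite /K1; lra.
have [i iC hi] := T_shadow w x z w0 x01 z01; exists i => //.
apply: le_trans hz; apply: visits_shadow => // j jw; rewrite -iterD addnC; exact: hi.
Qed.

(** A segment with many visits is shadowed within every segment [C + 1] times
    longer, which bounds the mean from below. *)
Lemma visits_high (c rho : R) w (x : R) : (0 < w)%N -> 0 < rho -> 0 <= x < 1 ->
  visits c rho w x <= C.+1%:R * (2 * rho * w%:R + K1).
Proof.
move=> w0 r0 x01; have wR : 0 < w%:R :> R by rewrite ltr0n.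
have r'0 : 0 < rho + K / w%:R by rewrite addr_gt0// divr_gt0.
apply: (@le_trans _ _ ((C.+1 * w)%:R * (2 * (rho + K / w%:R)))).
  apply: (visits_mean c) => // z z01.
  have [i iC hi] := T_shadow w z x w0 z01 x01.
  apply: (@le_trans _ _ (visits c (rho + K / w%:R) w (iter i T z))).
    apply: visits_shadow => // j jw; rewrite -iterD addnC distrC; exact: hi.
  apply: (@le_trans _ _ (visits c (rho + K / w%:R) (i + w) z)).
    by rewrite visitsD lerDr visits_ge0.
  by apply: visits_le; rewrite mulSn addnC leq_add2l.
rewrite natrM -mulrA ler_pM2l ?ltr0n//.
have -> : w%:R * (2 * (rho + K / w%:R)) = 2 * rho * w%:R + 2 * K.
  by field; rewrite gt_eqF.
by rewrite /K1; lra.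
Qed.

(** [Q] bounds from below the expected number of visits rather than the length
    of the segment: this makes the estimate the same at all scales, which balls
    of vanishing radius require. *)
Definition equidistributed (u Q : R) : Prop :=
  forall (c rho : R) (w : nat) (x : R), 0 < rho -> 2 * rho <= 1 -> 0 <= x < 1 -> Q <= 2 * rho * w%:R ->
  visits c rho w x <= (1 + u) * (2 * rho * w%:R).

Lemma equidistributed_le (u Q u' Q' : R) : u <= u' -> Q <= Q' ->
  equidistributed u Q -> equidistributed u' Q'.
Proof.
move=> uu QQ h c rho w x r0 r1 x01 Qw.
apply: (le_trans (h c rho w x r0 r1 x01 (le_trans QQ Qw))).
by rewrite ler_wpM2r ?lerD2l// !mulr_ge0// ltW.
Qed.

Let u0 : R := C.+1%:R * (1 + K1).

Lemma equidistributed_base : equidistributed u0 1.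
Proof.
move=> c rho w x r0 r1 x01 w1.
have w0 : (0 < w)%N by case: w w1 => //; rewrite mulr0; lra.
apply: (le_trans (visits_high c rho w x w0 r0 x01)).
have : 1 <= C.+1%:R :> R by rewrite ler1n.
rewrite /u0; set L := 2 * rho * w%:R in w1 *; move=> c1; have k1 := K1_gt0.
have : C.+1%:R * K1 <= C.+1%:R * K1 * L by rewrite ler_peMr// mulr_ge0// ltW.
nra.
Qed.

Lemma visits_any_length (u Q c rho : R) w0 : 0 <= u -> equidistributed u Q -> 0 < rho ->
  2 * rho <= 1 -> (0 < w0)%N -> Q <= 2 * rho * w0%:R ->
  forall a (x : R), 0 <= x < 1 ->
  visits c rho a x <= (1 + u) * (2 * rho * (a%:R + w0%:R)).
Proof.
move=> u_ge0 hu r0 r1 w00 Qw0; elim/ltn_ind => a ih x x01.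
have h0 : visits c rho w0 x <= (1 + u) * (2 * rho * w0%:R) by exact: hu.
have [aw|wa] := leqP a w0.
  apply: (le_trans (visits_le c rho _ _ x aw)); apply: (le_trans h0).
  rewrite ler_pM2l; last by lra.
  by rewrite ler_pM2l ?lerDr//; lra.
rewrite -(subnKC (ltnW wa)) visitsD natrD.
have := ih (a - w0)%N _ _ (iter_T_unit w0 x x01).
rewrite ltn_subrL w00 (ltn_trans w00 wa) => /(_ isT).
by move: h0; lra.
Qed.

(** A segment of length [w1] is cut into pieces of length [w0 = w1 / M], for
    which the excess is at most [u], except for one piece of length [A w0],
    a fixed proportion of the whole, which has no excess.  The number [A] of
    small pieces must be of order [1 / u] to make the rounding errors
    negligible. *)
Lemma equidistributed_step (U u Q : R) (A : nat) : 0 < u -> u <= U -> 1 <= Q ->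
  (0 < A)%N -> 4 * (1 + U) + 2 * K1 <= A%:R * u -> equidistributed u Q ->
  equidistributed ((1 - (4 * C.+1%:R)^-1) * u) (2 * (C.+1 * A)%:R * Q).
Proof.
move=> u_gt0 uU Q1 A0 Au hu c rho w1 x r0 r1 x01 Qw1.
(* a window of length [M * w0] contains a full segment of length [A * w0]
   within the recurrence time [C * (A * w0)] *)
pose M := (C.+1 * A)%N; have M0 : (0 < M)%N by rewrite muln_gt0.
have MR : 1 <= M%:R :> R by rewrite ler1n.
set L := 2 * rho in Qw1 r1 *; have L0 : 0 < L by rewrite /L; lra.
have LW : L * w1%:R <= w1%:R by rewrite ler_piMl// ltW.
have w1M : 2 * M%:R <= w1%:R :> R.
  apply: le_trans LW; apply: le_trans Qw1.
  by rewrite ler_peMr// mulr_ge0.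
pose w0 := (w1 %/ M)%N; pose w := (A * w0)%N.
have w1lt : w1%:R <= M%:R * w0%:R + M%:R :> R.
  rewrite -natrM -natrD ler_nat {1}(divn_eq w1 M) mulnC leq_add2l ltnW//.
  by rewrite ltn_mod.
have w1ge : M%:R * w0%:R <= w1%:R :> R by rewrite -natrM ler_nat mulnC leq_trunc_div.
have w1le : w1%:R <= 2 * (M%:R * w0%:R) :> R by lra.
have Qw0 : Q <= L * w0%:R.
  rewrite -(@ler_pM2l _ (2 * M%:R)); last by lra.
  apply: (le_trans Qw1); rewrite (_ : _ * (L * _) = L * (2 * (M%:R * w0%:R))); last by ring.
  by rewrite ler_pM2l.
have w00 : (0 < w0)%N.
  by rewrite lt0n; apply/eqP => w00; move: Qw0; rewrite w00 mulr0; lra.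
have w_gt0 : (0 < w)%N by rewrite muln_gt0 A0.
have [i iC hi] := visits_low c rho w x w_gt0 r0 x01.
have iw : (i + w <= w1)%N.
  apply: (@leq_trans (M * w0)).
    by rewrite /M -mulnA mulSn -/w addnC leq_add2l.
  by rewrite mulnC leq_trunc_div.
have any := visits_any_length u Q c rho w0 (ltW u_gt0) hu r0 r1 w00 Qw0.
have E : w1%:R = i%:R + w%:R + (w1 - (i + w))%:R :> R.
  by rewrite -!natrD subnKC.
have h1 := any i x x01.
have h2 := any (w1 - (i + w))%N (iter (i + w) T x) (iter_T_unit _ _ x01).
rewrite -{1}(subnKC iw) visitsD visitsD.
rewrite -/L in h1 h2 hi.
have e4 : (4 * C.+1%:R)^-1 * w1%:R <= w%:R / 2 :> R.
  rewrite -ler_pdivlMl ?invr_gt0 ?mulr_gt0// invrK.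
  apply: (le_trans w1le); rewrite /M /w !natrM; lra.
have wE : w%:R = A%:R * w0%:R :> R by rewrite /w natrM.
have Lw0 : 1 <= L * w0%:R by lra.
have f1 : (4 * (1 + U) + 2 * K1) * (L * w0%:R) <= A%:R * u * (L * w0%:R).
  by rewrite ler_wpM2r//; lra.
have f2 : L * u * ((4 * C.+1%:R)^-1 * w1%:R) <= L * u * (w%:R / 2).
  by rewrite ler_wpM2l// mulr_ge0// ltW.
have k1 := K1_gt0.
have f3 : K1 <= K1 * (L * w0%:R) by rewrite ler_peMr// ltW.
have f4 : u * (L * w0%:R) <= U * (L * w0%:R) by rewrite ler_wpM2r//; lra.
have G : (1 + u) * (L * (i%:R + w0%:R)) + (L * w%:R + K1) +
   (1 + u) * (L * ((w1 - (i + w))%:R + w0%:R)) <=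
   (1 + (1 - (4 * C.+1%:R)^-1) * u) * (L * w1%:R).
  set v := (4 * C.+1%:R)^-1 in e4 f2 *; set b := (w1 - (i + w))%:R in E h2 *.
  have -> : (1 + (1 - v) * u) * (L * w1%:R) =
    (1 + u) * (L * w1%:R) - L * u * (v * w1%:R) by ring.
  rewrite E in f2 *; rewrite wE in f2 *; lra.
by apply: le_trans G; rewrite lerD// lerD.
Qed.

(** Each contraction of [u] by a constant factor multiplies [Q] by about [1 / u].
    Going from [m = M - M / q] to [M] contracts [a / m^2] by such a factor,
    and allows [Q] to grow by [B ^ (M / q)], more than enough. *)
Lemma equidistributed_rate : exists a B : R, [/\ 0 < a, 4 <= B &
  forall m, (0 < m)%N -> equidistributed (a / m%:R ^+ 2) (B ^+ m)].
Proof.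
have c1 : 1 <= C.+1%:R :> R by rewrite ler1n.
have k1 := K1_gt1.
have u0_gt0 : 0 < u0 by rewrite /u0 mulr_gt0//; lra.
(* [1 - 2 / q] is the contraction factor of [equidistributed_step] *)
have [q qE] : exists q, q = (8 * C.+1)%N by eexists.
have q0 : (0 < q)%N by rewrite qE.
have qR : 0 < q%:R :> R by rewrite ltr0n.
pose a := u0 * q%:R ^+ 2; have a_gt0 : 0 < a by rewrite mulr_gt0// exprn_gt0.
pose E := 4 * (1 + a) + 2 * K1; have E0 : 0 < E by rewrite /E; lra.
pose G := 4 * C.+1%:R * E; have G0 : 0 < G by rewrite /G !mulr_gt0.
(* [G / u] bounds the factor lost on [Q] in one step, and [B ^ t] has to
   dominate it for [u = a / m^2], [m <= q * (t + 1)] *)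
pose B := 4 * (1 + 4 * q%:R ^+ 2 * (G / a)).
have Ga : 0 < G / a by rewrite divr_gt0.
have Z0 : 0 <= 4 * q%:R ^+ 2 * (G / a).
  by apply: mulr_ge0; [rewrite mulr_ge0// exprn_ge0|exact: ltW].
have B4 : 4 <= B by rewrite /B ler_peMr// lerDl.
have B1 : 1 <= B by lra.
exists a, B; split => //.
elim/ltn_ind => M ih M0.
have [Mq|qM] := ltnP M q.
  apply: (equidistributed_le _ _ _ _ _ _ equidistributed_base).
    rewrite /a -mulrA ler_pMr// -expr_div_n expr_ge1 ?divr_ge0//.
    by rewrite ler_pdivlMr ?ltr0n// mul1r ler_nat ltnW.
  exact: exprn_ege1.
pose t := (M %/ q)%N; have t0 : (0 < t)%N by rewrite divn_gt0.
have q1 : (1 < q)%N by rewrite qE (leq_trans _ (leq_pmulr 8 (ltn0Sn C))).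
have tM : (t < M)%N by exact: ltn_Pdiv.
pose m := (M - t)%N; have m0 : (0 < m)%N by rewrite subn_gt0.
have mM : (m < M)%N by rewrite ltn_subrL t0 (leq_trans q0).
have mR : 1 <= m%:R :> R by rewrite ler1n.
have m2 : 1 <= m%:R ^+ 2 :> R by rewrite exprn_ege1.
pose u := a / m%:R ^+ 2; have u_gt0 : 0 < u by rewrite divr_gt0// exprn_gt0//; lra.
have ua : u <= a by rewrite /u ler_pdivrMr; [rewrite ler_peMr// ltW|lra].
pose A := (Num.truncn (E / u)).+1.
have Eu : 0 < E / u by rewrite divr_gt0.
have AE : E <= A%:R * u by rewrite -ler_pdivrMr// ltW// truncnS_gt.
have AE2 : A%:R * u <= 2 * E.
  have h : (Num.truncn (E / u))%:R * u <= E.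
    by rewrite -ler_pdivlMr// truncn_le ltW.
  by rewrite /A -natr1 mulrDl mul1r; move: h ua; rewrite /E; lra.
have Bm : 1 <= B ^+ m by exact: exprn_ege1.
have := equidistributed_step a u (B ^+ m) A u_gt0 ua Bm (ltn0Sn _) AE (ih m mM m0).
apply: equidistributed_le.
-
  (* (1 - 2 / q) M^2 <= (M - t)^2 because t <= M / q *)
  rewrite /u mulrCA ler_pM2l// ler_pdivrMr ?exprn_gt0//; last by lra.
  rewrite ler_pdivlMl ?exprn_gt0 ?ltr0n//.
  have tq : t%:R * q%:R <= M%:R :> R by rewrite -natrM ler_nat leq_trunc_div.
  have mE : m%:R = M%:R - t%:R :> R by rewrite natrB// ltnW.
  have -> : (4 * C.+1%:R)^-1 = 2 / q%:R :> R by rewrite qE natrM; field; lra.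
  have tq' : t%:R <= M%:R / q%:R :> R by rewrite ler_pdivlMr.
  rewrite mE; have : 0 <= t%:R :> R by []. have : 0 <= M%:R :> R by [].
  move=> *; nra.
- rewrite natrM.
  have -> : B ^+ M = B ^+ t * B ^+ m by rewrite -exprD subnKC// ltnW.
  rewrite ler_pM2r; last by lra.
  have -> : 2 * (C.+1%:R * A%:R) = (2 * C.+1%:R) * (A%:R * u) * (m%:R ^+ 2 / a) :> R.
    by rewrite /u; field; lra.
  apply: (@le_trans _ _ (G / a * m%:R ^+ 2)).
    rewrite (_ : G / a * _ = 2 * C.+1%:R * (2 * E) * (m%:R ^+ 2 / a)); last by rewrite /G; field; lra.
    rewrite ler_pM2r; last by rewrite divr_gt0// ; lra.
    by rewrite ler_pM2l// ; lra.
  have mt : m%:R ^+ 2 <= 4 * q%:R ^+ 2 * 4 ^+ t :> R.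
    apply: (@le_trans _ _ ((2 * (q%:R * 2 ^+ t)) ^+ 2)).
      rewrite lerXn2r ?nnegrE// ?mulr_ge0// ?exprn_ge0//.
      rewrite -natrX -!natrM ler_nat (leq_trans (ltnW mM))//.
      apply: (@leq_trans (t.+1 * q)).
        by rewrite {1}(divn_eq M q) mulSnr leq_add2l ltnW// ltn_mod.
      apply: (@leq_trans (q * 2 ^ t)); last exact: leq_pmull.
      by rewrite mulnC leq_mul2l ltn_expl// orbT.
    have -> : 4 ^+ t = (2 ^+ t) ^+ 2 :> R.
      by rewrite -exprM mulnC exprM; congr (_ ^+ _); ring.
    by rewrite le_eqVlt; apply/orP; left; apply/eqP; ring.
  apply: (@le_trans _ _ (G / a * (4 * q%:R ^+ 2 * 4 ^+ t))); first by rewrite ler_pM2l.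
  rewrite (_ : B = 4 * (1 + 4 * q%:R ^+ 2 * (G / a)))// exprMn.
  set Z := 4 * q%:R ^+ 2 * (G / a) in Z0 *.
  rewrite (_ : G / a * _ = 4 ^+ t * Z); last by rewrite /Z; ring.
  rewrite ler_pM2l ?exprn_gt0//.
  apply: (@le_trans _ _ (1 + Z)); first by lra.
  by rewrite -[leLHS]expr1 ler_weXn2l//; lra.
Qed.

End Equidistribution.

(** * Variance of the number of hits *)

Lemma sym_double_sum {R : realType} (h : nat -> nat -> R) N :
  (forall i j, h i j = h j i) ->
  \sum_(0 <= i < N) \sum_(0 <= j < N) h i j =
  \sum_(0 <= i < N) h i i + 2 * \sum_(0 <= i < N) \sum_(i.+1 <= j < N) h i j.
Proof.
move=> hs; elim: N => [|N ih]; first by rewrite !big_geq// mulr0 addr0.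
rewrite [LHS]big_nat_recr//= [X in _ = X + _]big_nat_recr//=.
rewrite [X in _ = _ + 2 * X]big_nat_recr//= [X in _ = _ + 2 * (_ + X)]big_geq// addr0.
rewrite [\sum_(0 <= j < N.+1) h N j]big_nat_recr//=.
under eq_bigr do rewrite big_nat_recr//=.
rewrite big_split/= ih.
have -> : \sum_(0 <= i < N) \sum_(i.+1 <= j < N.+1) h i j =
    \sum_(0 <= i < N) \sum_(i.+1 <= j < N) h i j + \sum_(0 <= i < N) h i N.
  rewrite -big_split/= big_seq [RHS]big_seq; apply: eq_bigr => i.
  by rewrite mem_index_iota => /andP[_ iN]; rewrite big_nat_recr.
have -> : \sum_(0 <= j < N) h N j = \sum_(0 <= i < N) h i N.
  by apply: eq_bigr => i _; exact: hs.
lra.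
Qed.

(** The measure in the unit interval of the ball of radius [rho] about 1/2. *)
Definition ball_meas {R : realType} (rho : R) : R := Num.min 1 (2 * rho).

Lemma umeas_half_ball {R : realType} (rho : R) : 0 < rho ->
  umeas (ball (2^-1 : R) rho) = ball_meas rho.
Proof.
have small (r : R) : 0 < r -> 2 * r <= 1 -> umeas (ball (2^-1 : R) r) = 2 * r.
  move=> r0 r1; rewrite /umeas.
  have -> : ball (2^-1 : R) r `&` `[0, 1[%classic = `]2^-1 - r, 2^-1 + r[%classic :> set R.
    apply/seteqP; split => x /=; rewrite /ball/= !in_itv/= ltr_norml.
      by move=> []; lra.
    by move=> h; split; lra.
  rewrite lebesgue_measure_itv/= lte_fin; case: ltP => /= h; lra.
move=> r0; rewrite /ball_meas; case: leP => h; last by rewrite small// ltW.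
apply/eqP; rewrite eq_le; apply/andP; split.
  by rewrite -umeasT; apply: umeas_le => //; exact: measurable_ball.
apply: (@le_trans _ _ (umeas (ball (2^-1 : R) 2^-1))); first by rewrite small; lra.
apply: umeas_le; [exact: measurable_ball|exact: measurable_ball|].
by move=> x _; rewrite /ball/= => /lt_le_trans; apply; lra.
Qed.

Section Variance.
Context {R : realType} (T : R -> R).
Hypothesis T_unit : forall x, 0 <= x < 1 -> 0 <= T x < 1.
Hypothesis T_measurable : forall i A, measurable A -> measurable (iter i T @^-1` A).
Hypothesis T_umeas : forall i A, measurable A -> umeas (iter i T @^-1` A) = umeas A.
Context (rho : nat -> R).
Hypothesis rho_gt0 : forall j, 0 < rho j.
Hypothesis rho_noninc : forall i j, (i <= j)%N -> rho j <= rho i.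

Definition target (j : nat) : set R := ball (2^-1 : R) (rho j).

(** Indices are shifted by one: time [j + 1] is paired with the [j]-th radius. *)
Definition hit_event (j : nat) : set R := iter j.+1 T @^-1` target j.

Definition hit_count (N : nat) (x : R) : R := \sum_(0 <= j < N) \1_(hit_event j) x.

Definition expected (N : nat) : R := \sum_(0 <= j < N) ball_meas (rho j).

Let b j := ball_meas (rho j).

Lemma ball_meas_gt0 j : 0 < b j.
Proof. by rewrite /b /ball_meas lt_min ltr01 mulr_gt0. Qed.

Lemma ball_meas_le1 j : b j <= 1.
Proof. by rewrite /b /ball_meas ge_min lexx. Qed.

Lemma ball_meas_noninc i j : (i <= j)%N -> b j <= b i.
Proof.
move=> /rho_noninc ij; rewrite /b /ball_meas le_min !ge_min lexx/=.
by apply/orP; right; rewrite ler_pM2l.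
Qed.

Lemma measurable_target j : measurable (target j).
Proof. exact: measurable_ball. Qed.

Lemma measurable_hit_event j : measurable (hit_event j).
Proof. by apply: T_measurable; exact: measurable_target. Qed.

Lemma umeas_target j : umeas (target j) = b j.
Proof. exact: umeas_half_ball. Qed.

Lemma visits_target u Q j w x : 0 <= u -> equidistributed T u Q -> 0 <= x < 1 ->
  Q <= b j * w%:R ->
  visits T 2^-1 (rho j) w x <= (1 + u) * (b j * w%:R).
Proof.
move=> u0 hu x01; rewrite /b /ball_meas; case: (leP 1 (2 * rho j)) => h Qw.
  apply: (@le_trans _ _ w%:R); last by rewrite mul1r ler_peMl// lerDl.
  have -> : w%:R = \sum_(0 <= i < w) 1 :> R by rewrite sumr_const_nat subn0.
  apply: ler_sum => i _.
  by have /andP[] := indic_le1 (ball (2^-1 : R) (rho j)) (iter i T x).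
by apply: (hu 2^-1 (rho j) w x) => //; exact: ltW.
Qed.

(** Shifting all the sets by [T^(-(s + w - k))] makes the later target
    independent of [k], so the sum counts visits to the earlier target by a
    segment of length [w]. *)
Lemma pair_block u Q j s w : 0 <= u -> equidistributed T u Q -> Q <= b j * w%:R ->
  \sum_(s <= k < s + w) umeas (hit_event j `&` hit_event (j + k)) <=
  (1 + u) * (b j * w%:R) * b (j + s).
Proof.
move=> u0 hu Qw.
pose G := target (j + s).
pose S i := iter i T @^-1` target j `&` iter (s + w) T @^-1` G.
have mG : measurable (iter (s + w) T @^-1` G) by apply: T_measurable; exact: measurable_target.
have mS i : measurable (S i).
  by apply: measurableI => //; apply: T_measurable; exact: measurable_target.
apply: (@le_trans _ _ (\sum_(s <= k < s + w) umeas (S (s + w - k)%N))).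
  rewrite big_seq [leRHS]big_seq; apply: ler_sum => k; rewrite mem_index_iota => /andP[sk ksw].
  pose Z A := iter j.+1 T @^-1` (target j `&` iter k T @^-1` A).
  have mZ' l : measurable (target j `&` iter k T @^-1` (target l)).
    apply: measurableI; first exact: measurable_target.
    by apply: T_measurable; exact: measurable_target.
  have -> : hit_event j `&` hit_event (j + k) = Z (target (j + k)).
    have e x : iter (j + k).+1 T x = iter k T (iter j.+1 T x).
      by rewrite -iterD addnS addnC.
    apply/seteqP; split => x [h1 h2]; split => //; move: h2;
      by rewrite /hit_event /preimage /mkset e.
  have -> : S (s + w - k)%N = iter (s + w - k) T @^-1` (target j `&` iter k T @^-1` G).
    apply/seteqP; split => x; rewrite /S/= => -[h1 h2]; split => //;
      by move: h2; rewrite -iterD subnKC// ltnW.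
  rewrite /Z T_umeas; last exact: mZ'.
  rewrite T_umeas; last exact: mZ'.
  apply: umeas_le; [exact: mZ'|exact: mZ'|].
  move=> x _ [h1 h2]; split => //; move: h2; rewrite /target /ball/=.
  by move=> /lt_le_trans; apply; apply: rho_noninc; rewrite leq_add2l.
have -> : \sum_(s <= k < s + w) umeas (S (s + w - k)%N) =
    \sum_(0 <= k < w) umeas (S (w - k)%N).
  rewrite -{1}[s]add0n big_addn addKn; apply: eq_bigr => k _; congr (umeas (S _)).
  by rewrite [(k + s)%N]addnC subnDl.
rewrite -[b (j + s)]umeas_target -(T_umeas (s + w) _ (measurable_target (j + s))).
apply: umeas_sum_le_indic => // x x01.
(* both sides vanish outside [G]; on it, the indicators on the left count
   the visits of the segment of length [w] that starts at [T x] *)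
have [Gx|nGx] := pselect (G (iter (s + w) T x)); last first.
  rewrite [X in _ <= _ * X]indicE memNset// mulr0 big1// => k _.
  by rewrite indicE memNset//; case.
rewrite [X in _ <= _ * X]indicE mem_set// mulr1.
apply: le_trans (visits_target u Q j w (T x) u0 hu (T_unit _ x01) Qw).
rewrite /visits [leRHS]big_nat_rev/= add0n big_seq [leRHS]big_seq.
apply: ler_sum => k; rewrite mem_index_iota => /andP[_ kw].
rewrite -iterSr -subSn// subSS.
rewrite !indicE; case: (boolP (x \in _)) => [/set_mem[h _]|_]; last by case: (_ \in _).
by rewrite mem_set.
Qed.

(** By monotonicity, each block is dominated by the expected contribution of
    the block before it, and the first one by [w * b (j + s)]. *)
Lemma pair_sum u Q j w : 0 <= u -> equidistributed T u Q -> Q <= b j * w%:R ->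
  (0 < w)%N -> forall n s,
  \sum_(s <= k < s + n) umeas (hit_event j `&` hit_event (j + k)) <=
  (1 + u) * b j * (w%:R * b (j + s) + \sum_(s <= k < s + n) b (j + k)).
Proof.
move=> u0 hu Qw w0; elim/ltn_ind => n ih s.
have c0 : 0 <= (1 + u) * b j by rewrite mulr_ge0 ?addr_ge0// ltW// ball_meas_gt0.
have block := pair_block u Q j s w u0 hu Qw.
have [nw|wn] := leqP n w.
  apply: (@le_trans _ _ (\sum_(s <= k < s + w) umeas (hit_event j `&` hit_event (j + k)))).
    rewrite [leRHS](big_cat_nat (leq_addr n s))/= ?leq_add2l// lerDl.
    by apply: sumr_ge0 => k _; exact: umeas_ge0.
  apply: (le_trans block).
  rewrite (_ : (1 + u) * (b j * w%:R) * b (j + s) = (1 + u) * b j * (w%:R * b (j + s))); last by ring.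
  rewrite ler_wpM2l// lerDl; apply: sumr_ge0 => k _; exact/ltW/ball_meas_gt0.
have [sw1 sw2] : (s <= s + w)%N /\ (s + w <= s + n)%N by rewrite leq_addr leq_add2l ltnW.
rewrite (big_cat_nat sw1 sw2)/= [X in w%:R * _ + X](big_cat_nat sw1 sw2)/=.
have := ih (n - w)%N _ (s + w)%N; rewrite ltn_subrL w0 (ltn_trans w0 wn) => /(_ isT).
rewrite -addnA subnKC; last exact: ltnW.
have h : w%:R * b (j + (s + w)) <= \sum_(s <= k < s + w) b (j + k).
  rewrite -[w in w%:R](addKn s) mulr_natl -sumr_const_nat big_seq [leRHS]big_seq.
  apply: ler_sum => k; rewrite mem_index_iota => /andP[_ ksw].
  by apply: ball_meas_noninc; rewrite leq_add2l ltnW.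
move=> h2; apply: (le_trans (lerD block h2)).
rewrite (_ : (1 + u) * (b j * w%:R) * b (j + s) = (1 + u) * b j * (w%:R * b (j + s))); last by ring.
by rewrite -mulrDr ler_wpM2l//; lra.
Qed.

Lemma expected_ge0 N : 0 <= expected N.
Proof. by apply: sumr_ge0 => j _; exact/ltW/ball_meas_gt0. Qed.

(** With [w] the least length such that [b i * w > Q], the first block
    contributes at most [(1 + u) (Q + 1) b i]. *)
Lemma second_moment u Q N : 0 <= u -> 0 <= Q -> equidistributed T u Q ->
  \sum_(0 <= i < N) \sum_(0 <= j < N) umeas (hit_event i `&` hit_event j) <=
  (1 + u) * expected N ^+ 2 + (1 + 2 * (1 + u) * (Q + 1)) * expected N.
Proof.
move=> u0 Q0 hu.
rewrite (sym_double_sum (fun i j => umeas (hit_event i `&` hit_event j))); last first.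
  by move=> i j; rewrite setIC.
have -> : expected N ^+ 2 = \sum_(0 <= i < N) b i * b i +
    2 * \sum_(0 <= i < N) \sum_(i.+1 <= j < N) b i * b j.
  rewrite -(sym_double_sum (fun i j => b i * b j)); last by move=> i j; rewrite mulrC.
  by rewrite expr2 /expected mulr_suml; apply: eq_bigr => i _; rewrite mulr_sumr.
have -> : \sum_(0 <= i < N) umeas (hit_event i `&` hit_event i) = expected N.
  apply: eq_bigr => i _; rewrite setIid T_umeas; first exact: umeas_target.
  exact: measurable_target.
suff h : \sum_(0 <= i < N) \sum_(i.+1 <= j < N) umeas (hit_event i `&` hit_event j) <=
   (1 + u) * (Q + 1) * expected N +
   (1 + u) * \sum_(0 <= i < N) \sum_(i.+1 <= j < N) b i * b j.
  have h2 : 0 <= (1 + u) * \sum_(0 <= i < N) b i * b i.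
    rewrite mulr_ge0 ?addr_ge0//; apply: sumr_ge0 => i _.
    by rewrite mulr_ge0// ltW// ball_meas_gt0.
  by move: h h2; rewrite !mulrDr; lra.
rewrite /expected !mulr_sumr -big_split/= big_seq [leRHS]big_seq.
apply: ler_sum => i; rewrite mem_index_iota => /andP[_ iN].
pose w := (Num.truncn (Q / b i)).+1.
have bi := ball_meas_gt0 i.
have Qw : Q <= b i * w%:R.
  by rewrite mulrC -ler_pdivrMr// ltW// truncnS_gt.
have bw : b i * w%:R <= Q + 1.
  have h : (Num.truncn (Q / b i))%:R * b i <= Q.
    by rewrite -ler_pdivlMr// truncn_le divr_ge0// ltW.
  rewrite /w -natr1 mulrDr mulr1 mulrC; apply: lerD => //; exact: ball_meas_le1.
have := pair_sum u Q i w u0 hu Qw (ltn0Sn _) (N - i.+1) 1.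
have shift (f : nat -> R) : \sum_(i.+1 <= j < N) f j =
    \sum_(1 <= k < 1 + (N - i.+1)) f (i + k)%N.
  have -> : (1 + (N - i.+1) = N - i)%N by clear - iN; lia.
  by rewrite -[in LHS]add1n big_addn; apply: eq_bigr => k _; rewrite addnC.
rewrite -(shift (fun l => umeas (hit_event i `&` hit_event l))) -(shift b).
move=> /le_trans; apply.
rewrite -[in leRHS]mulr_sumr -/(b i); set S := \sum_(i.+1 <= j < N) b j.
have h : b i * w%:R * b (i + 1) <= (Q + 1) * b i.
  apply: ler_pM => //; [by rewrite mulr_ge0// ltW|exact/ltW/ball_meas_gt0|].
  by apply: ball_meas_noninc; rewrite leq_addr.
have u1 : 0 <= 1 + u by rewrite addr_ge0.
by have := ler_wpM2l u1 h; lra.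
Qed.

Definition deviation (eps : R) (N : nat) : set R :=
  [set x | eps * expected N <= `|hit_count N x - expected N|].

Lemma measurable_hit_count N : measurable_fun [set: R] (hit_count N).
Proof.
apply: measurable_sum => j; apply: measurable_indic; exact: measurable_hit_event.
Qed.

Lemma measurable_deviation eps N : measurable (deviation eps N).
Proof.
rewrite (_ : deviation eps N =
  (fun x => `|hit_count N x - expected N|) @^-1` `[eps * expected N, +oo[%classic); last first.
  by apply/seteqP; split => x; rewrite /deviation/= in_itv/= andbT.
rewrite -[_ @^-1` _]setTI.
have mf : measurable_fun [set: R] (fun x => `|hit_count N x - expected N|).
  apply: measurableT_comp; first exact: normr_measurable.
  apply: measurable_funB; [exact: measurable_hit_count|exact: measurable_cst].
by apply: mf => //; exact: measurable_itv.
Qed.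

Lemma chebyshev_hit_count eps N : 0 <= eps ->
  eps ^+ 2 * expected N ^+ 2 * umeas (deviation eps N) <=
  \sum_(0 <= i < N) \sum_(0 <= j < N) umeas (hit_event i `&` hit_event j) - expected N ^+ 2.
Proof.
move=> e0; set E := expected N.
pose I := option (nat * nat + nat).
pose A (o : I) := match o with
  | None => deviation eps N | Some (inl p) => hit_event p.1 `&` hit_event p.2
  | Some (inr i) => hit_event i end.
pose c (o : I) := match o with
  | None => - (eps ^+ 2 * E ^+ 2) | Some (inl p) => 1 | Some (inr i) => - (2 * E) end.
pose s : seq I := None :: map (fun p => Some (inl p))
    [seq (i, j) | i <- index_iota 0 N, j <- index_iota 0 N] ++
  map (fun i => Some (inr i)) (index_iota 0 N).
have mA o : measurable (A o).
  case: o => [[p|i]|] /=; [|exact: measurable_hit_event|exact: measurable_deviation].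
  by apply: measurableI; exact: measurable_hit_event.
have sumE (F : I -> R) : \sum_(o <- s) F o = F None +
    (\sum_(0 <= i < N) \sum_(0 <= j < N) F (Some (inl (i, j))) +
     \sum_(0 <= i < N) F (Some (inr i))).
  by rewrite /s big_cons big_cat !big_map/= big_allpairs.
have := @umeas_comb_ge0 R I s (E ^+ 2) c A mA; rewrite sumE/=.
have -> : \sum_(0 <= i < N) - (2 * E) * umeas (hit_event i) = - (2 * E) * E.
  rewrite -mulr_sumr; congr (_ * _); apply: eq_bigr => i _.
  by rewrite T_umeas ?umeas_target//; exact: measurable_target.
under eq_bigr do under eq_bigr do rewrite mul1r.
suff h : forall x, 0 <= x < 1 -> 0 <= E ^+ 2 + \sum_(i <- s) c i * \1_(A i) x.
  by move=> /(_ h); lra.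
move=> x x01; rewrite sumE/=.
under eq_bigr do under eq_bigr do rewrite mul1r indicI.
have -> : \sum_(0 <= i < N) \sum_(0 <= j < N) (\1_(hit_event i) \* \1_(hit_event j)) x
    = hit_count N x ^+ 2 :> R.
  by rewrite expr2 /hit_count mulr_suml; apply: eq_bigr => i _; rewrite mulr_sumr.
rewrite -mulr_sumr -/(hit_count N x).
suff : eps ^+ 2 * E ^+ 2 * \1_(deviation eps N) x <= (hit_count N x - E) ^+ 2 by nra.
have [dx|ndx] := pselect (deviation eps N x); last first.
  by rewrite indicE memNset// mulr0 sqr_ge0.
rewrite indicE mem_set// mulr1 -exprMn -[leRHS]real_normK ?num_real//.
by rewrite lerXn2r ?nnegrE ?mulr_ge0 ?expected_ge0.
Qed.

End Variance.

(** * Almost sure convergence *)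

Lemma sum_inv_sq {R : realType} n :
  \sum_(0 <= j < n) (j.+1%:R ^+ 2)^-1 <= 2 - n%:R^-1 :> R.
Proof.
case: n => [|n]; first by rewrite big_geq// invr0; lra.
elim: n => [|n ih]; first by rewrite big_nat1 expr1n invr1; lra.
rewrite big_nat_recr//=; apply: (le_trans (lerD ih (lexx _))).
have n0 : 0 < n.+1%:R :> R by rewrite ltr0n.
have nE : n.+2%:R = n.+1%:R + 1 :> R by rewrite natr1.
set p := n.+1%:R in n0 nE *; rewrite nE.
have p1 : p^-1 - (p + 1)^-1 = p^-1 * (p + 1)^-1 by field; lra.
suff h : ((p + 1) ^+ 2)^-1 <= p^-1 - (p + 1)^-1.
  by apply: le_trans (lerD (lexx _) h) _; rewrite addrA subrK.
rewrite p1.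
have p10 : 0 < p + 1 by lra.
by rewrite expr2 invfM ler_pM2r ?invr_gt0// lef_pV2 ?posrE// lerDl.
Qed.

Lemma expr_unbounded {R : realType} (theta M : R) : 1 < theta ->
  exists n, M <= theta ^+ n.
Proof.
move=> t1; have bern n : 1 + n%:R * (theta - 1) <= theta ^+ n.
  elim: n => [|n ih]; first by rewrite mul0r expr0; lra.
  have h1 : 0 <= n%:R * (theta - 1) ^+ 2 by rewrite mulr_ge0 ?sqr_ge0.
  have th0 : 0 <= theta by lra.
  have h2 := ler_wpM2l th0 ih.
  by rewrite exprS -natr1; lra.
exists (Num.truncn (M / (theta - 1))).+1; apply: le_trans (bern _).
have : M / (theta - 1) * (theta - 1) <= (Num.truncn (M / (theta - 1))).+1%:R * (theta - 1).
  by rewrite ler_wpM2r ?subr_ge0 ?(ltW t1)// ltW// truncnS_gt.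
rewrite divfK; first by lra.
by rewrite subr_eq0 gt_eqF.
Qed.

Section Convergence.
Context {R : realType} (T : R -> R).
Hypothesis T_unit : forall x, 0 <= x < 1 -> 0 <= T x < 1.
Hypothesis T_measurable : forall i A, measurable A -> measurable (iter i T @^-1` A).
Hypothesis T_umeas : forall i A, measurable A -> umeas (iter i T @^-1` A) = umeas A.
Context (rho : nat -> R).
Hypothesis rho_gt0 : forall j, 0 < rho j.
Hypothesis rho_noninc : forall i j, (i <= j)%N -> rho j <= rho i.
Context (a B : R).
Hypothesis a_gt0 : 0 < a.
Hypothesis B_ge4 : 4 <= B.
Hypothesis T_rate : forall m, (0 < m)%N -> equidistributed T (a / m%:R ^+ 2) (B ^+ m).

Local Notation E := (expected rho).
Local Notation dev := (deviation T rho).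

Hypothesis E_unbounded : forall M, exists N, M <= E N.

(** Chebyshev with [u = a / m^2] and [Q = B^m]: the second error term is
    [O(Q / E N)], and [E N >= Q^2]. *)
Lemma deviation_bound eps m N : 0 < eps -> (0 < m)%N -> B ^+ (2 * m) <= E N ->
  umeas (dev eps N) <= (5 * a + 5) / eps ^+ 2 / m%:R ^+ 2.
Proof.
move=> e0 m0; rewrite mulnC exprM; set Q := B ^+ m => QE.
have m2 : 1 <= m%:R ^+ 2 :> R by rewrite exprn_ege1// ler1n.
have m2Q : m%:R ^+ 2 <= Q.
  apply: (@le_trans _ _ (4 ^+ m)); last by rewrite lerXn2r ?nnegrE//; have := B_ge4; lra.
  rewrite (_ : 4 = 2 ^+ 2); last by ring.
  rewrite -exprM mulnC exprM lerXn2r ?nnegrE ?exprn_ge0//.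
  by rewrite -natrX ler_nat ltnW// ltn_expl.
have Q1 : 1 <= Q by exact: le_trans m2Q.
pose u := a / m%:R ^+ 2.
have u0 : 0 < u by rewrite divr_gt0//; lra.
have um : u * m%:R ^+ 2 = a by rewrite /u divfK// gt_eqF//; lra.
have ua : u <= a by rewrite -um ler_peMr// ltW.
have E0 : 0 < E N by apply: lt_le_trans QE; rewrite exprn_gt0//; lra.
have h1 := chebyshev_hit_count T T_measurable T_umeas rho rho_gt0 eps N (ltW e0).
have Q0 : 0 <= Q by lra.
have h2 := second_moment T T_unit T_measurable T_umeas rho rho_gt0 rho_noninc
   u Q N (ltW u0) Q0 (T_rate m m0).
rewrite ler_pdivlMr ?exprn_gt0 ?ltr0n//.
rewrite ler_pdivlMr ?exprn_gt0//.
set v := umeas _ in h1 *.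
have E2 : 0 < E N ^+ 2 by rewrite exprn_gt0.
rewrite -(ler_pM2l E2).
have h3 : eps ^+ 2 * E N ^+ 2 * v <= u * E N ^+ 2 + (5 + 4 * a) * Q * E N.
  have : (1 + 2 * (1 + u) * (Q + 1)) * E N <= (5 + 4 * a) * Q * E N.
    rewrite ler_pM2r//.
    have : u * Q <= a * Q by rewrite ler_wpM2r.
    have : a <= a * Q by rewrite ler_peMr// ltW.
    lra.
  by move: h1 h2; lra.
have h4 : Q * E N * m%:R ^+ 2 <= E N ^+ 2.
  rewrite expr2 -mulrA mulrCA ler_pM2l//.
  apply: le_trans QE; rewrite expr2 ler_wpM2l//.
have m20 : 0 <= m%:R ^+ 2 :> R by lra.
have h5 := ler_wpM2r m20 h3.
apply: (@le_trans _ _ (eps ^+ 2 * E N ^+ 2 * v * m%:R ^+ 2)); first by lra.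
apply: (le_trans h5).
have -> : (u * E N ^+ 2 + (5 + 4 * a) * Q * E N) * m%:R ^+ 2 =
   u * m%:R ^+ 2 * E N ^+ 2 + (5 + 4 * a) * (Q * E N * m%:R ^+ 2) by ring.
rewrite um; have : (5 + 4 * a) * (Q * E N * m%:R ^+ 2) <= (5 + 4 * a) * E N ^+ 2.
  by rewrite ler_wpM2l//; have := a_gt0; lra.
lra.
Qed.

Lemma umeas_le1 (A : set R) : measurable A -> umeas A <= 1.
Proof. by move=> mA; rewrite -umeasT; apply: umeas_le. Qed.

(** At level [j] the rate is used with [m = j / q], where [q] is such that
    [theta ^ q >= B ^ 2]. *)
Lemma level_deviation_bound eps theta (level : nat -> nat) : 0 < eps -> 1 < theta ->
  (forall j, theta ^+ j <= E (level j)) ->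
  exists2 K, 0 <= K & forall j, umeas (dev eps (level j)) <= K / j.+1%:R ^+ 2.
Proof.
move=> e0 t1 hl.
have [q' Bq'] := expr_unbounded theta (B ^+ 2) t1.
have [q [q0 Bq]] : exists q, (0 < q)%N /\ B ^+ 2 <= theta ^+ q.
  exists q'.+1; split => //; apply: (le_trans Bq').
  by rewrite ler_weXn2l// ltW.
pose K' := (5 * a + 5) / eps ^+ 2.
have K'0 : 0 < K' by rewrite divr_gt0 ?exprn_gt0//; have := a_gt0; lra.
have q2 : 0 < q%:R ^+ 2 :> R by rewrite exprn_gt0// ltr0n.
have K'q : 0 <= 4 * K' * q%:R ^+ 2 by apply: mulr_ge0 (ltW q2); exact: mulr_ge0 (ltW K'0).
exists (q%:R ^+ 2 + 4 * K' * q%:R ^+ 2) => [|j]; first by rewrite addr_ge0// ltW.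
have j0 : 0 < j.+1%:R ^+ 2 :> R by rewrite exprn_gt0// ltr0n.
have [jq|qj] := ltnP j q.
  apply: (le_trans (umeas_le1 _ (measurable_deviation T T_measurable rho _ _))).
  rewrite ler_pdivlMr// mul1r.
  have : j.+1%:R ^+ 2 <= q%:R ^+ 2 :> R by rewrite lerXn2r ?nnegrE// ler_nat.
  lra.
pose m := (j %/ q)%N; have m0 : (0 < m)%N by rewrite divn_gt0.
have mR : 0 < m%:R ^+ 2 :> R by rewrite exprn_gt0// ltr0n.
apply: (le_trans (deviation_bound eps m (level j) e0 m0 _)).
  apply: le_trans (hl j); apply: (@le_trans _ _ ((theta ^+ q) ^+ m)).
    rewrite exprM lerXn2r ?nnegrE ?exprn_ge0//; last by lra.
    by have := B_ge4; lra.
  by rewrite -exprM ler_weXn2l ?(ltW t1)// mulnC leq_trunc_div.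
rewrite -/K' ler_pdivlMr// mulrAC ler_pdivrMr//.
have jm : j.+1%:R <= 2 * q%:R * m%:R :> R.
  rewrite -!natrM ler_nat.
  apply: (@leq_trans (m.+1 * q)); first by rewrite {1}(divn_eq j q) mulSnr -addnS leq_add2l ltn_mod.
  by rewrite -mulnA [(q * m)%N]mulnC mulnA leq_mul2r mul2n -addnn -add1n leq_add2r m0 orbT.
have jm2 : j.+1%:R ^+ 2 <= 4 * q%:R ^+ 2 * m%:R ^+ 2 :> R.
  rewrite (_ : 4 * _ * _ = (2 * q%:R * m%:R) ^+ 2); last by ring.
  by rewrite lerXn2r ?nnegrE ?mulr_ge0.
apply: (@le_trans _ _ (K' * (4 * q%:R ^+ 2 * m%:R ^+ 2))); first by rewrite ler_pM2l.
have : 0 <= q%:R ^+ 2 * m%:R ^+ 2 :> R by rewrite mulr_ge0 ?ltW.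
lra.
Qed.

Lemma level_deviation_ae eps theta (level : nat -> nat) : 0 < eps -> 1 < theta ->
  (forall j, theta ^+ j <= E (level j)) ->
  {ae @lebesgue_measure R, forall x : R, 0 <= x < 1 ->
     exists J, forall j, (J <= j)%N -> ~ dev eps (level j) x}.
Proof.
move=> e0 t1 hl; have [K K0 hK] := level_deviation_bound eps theta level e0 t1 hl.
pose F j := dev eps (level j) `&` `[0, 1[%classic.
have mF j : measurable (F j).
  apply: measurableI; last exact: measurable_itv.
  exact: (measurable_deviation T T_measurable rho).
exists (lim_sup_set F); split.
- by apply: bigcap_measurable => // k _; apply: bigcup_measurable => j _; exact: mF.
- apply: lim_sup_set_cvg0 => //.
  apply: (@le_lt_trans _ _ (2 * K)%:E); last exact: ltry.
  apply: lime_le; first by apply: is_cvg_nneseries => n _ _; exact: measure_ge0.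
  apply: nearW => n.
  apply: (@le_trans _ _ (\sum_(0 <= j < n) (K / j.+1%:R ^+ 2)%:E)%E).
    apply: lee_sum => j _.
    have h : (@lebesgue_measure R (F j) <= (K / j.+1%:R ^+ 2)%:E)%E.
      rewrite /F umeas_fin ?lee_fin//.
      exact: (measurable_deviation T T_measurable rho).
    exact: h.
  rewrite sumEFin lee_fin -mulr_sumr mulrC ler_wpM2r//.
  by apply: (le_trans (sum_inv_sq n)); rewrite gerBl invr_ge0.
- move=> x /= nx; have [x01 hx] : 0 <= x < 1 /\
      ~ exists J, forall j, (J <= j)%N -> ~ dev eps (level j) x by exact/not_implyP.
  move=> n _; apply: contrapT => h; apply: hx; exists n => j nj dj.
  by apply: h; exists j => //; split => //=; rewrite in_itv.
Qed.

Lemma expected_le n m : (n <= m)%N -> E n <= E m.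
Proof.
move=> /subnKC <-; rewrite /expected (big_cat_nat (leq0n n) (leq_addr _ n))/= lerDl.
by apply: sumr_ge0 => j _; exact/ltW/ball_meas_gt0.
Qed.

Lemma hit_count_le n m x : (n <= m)%N -> hit_count T rho n x <= hit_count T rho m x.
Proof.
move=> /subnKC <-; rewrite /hit_count (big_cat_nat (leq0n n) (leq_addr _ n))/= lerDl.
by apply: sumr_ge0 => j _; have /andP[] := indic_le1 (hit_event T rho j) x.
Qed.

Lemma level_exists theta : exists level : nat -> nat, forall j,
  theta ^+ j <= E (level j) /\ forall n, (n < level j)%N -> E n < theta ^+ j.
Proof.
suff h j : exists l, theta ^+ j <= E l /\ forall n, (n < l)%N -> E n < theta ^+ j.
  by have [level hl] := choice h; exists level.
case: (ex_minnP (E_unbounded (theta ^+ j))) => l hl lmin; exists l; split => // n nl.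
by rewrite ltNge; apply/negP => /lmin; rewrite leqNgt nl.
Qed.

(** Between two consecutive levels both counts are monotone, and the expected
    one grows by a factor of at most [1 + eps], up to a jump of at most 1. *)
Lemma interpolation eps level x J : 0 < eps -> eps <= 1 ->
  (forall j, (1 + eps) ^+ j <= E (level j) /\
     forall n, (n < level j)%N -> E n < (1 + eps) ^+ j) ->
  (forall j, (J <= j)%N -> ~ dev eps (level j) x) ->
  exists M, forall n, (M <= n)%N -> `|hit_count T rho n x - E n| <= 6 * eps * E n.
Proof.
move=> e0 e1 hl hx; set theta := 1 + eps in hl.
have t1 : 1 < theta by rewrite /theta; lra.
have close j : (J <= j)%N -> `|hit_count T rho (level j) x - E (level j)| < eps * E (level j).
  by move=> /hx nd; rewrite ltNge; apply/negP.
(* beyond [eps^-1], the jump of at most 1 at each level is at most [eps * E n] *)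
have [M hM] := E_unbounded (Num.max (theta ^+ J) eps^-1).
exists M => n Mn.
have En := le_trans hM (expected_le _ _ Mn).
have EJ : theta ^+ J <= E n by apply: le_trans En; rewrite le_max lexx.
have Ee : 1 <= eps * E n.
  by rewrite -ler_pdivrMl// mulr1; apply: le_trans En; rewrite le_max lexx orbT.
have ex : exists j, E n < theta ^+ j.+1.
  have [j hj] := expr_unbounded theta (E n + 1) t1; exists j.
  apply: (@lt_le_trans _ _ (theta ^+ j)); first by lra.
  by rewrite ler_weXn2l ?leqnSn// ltW.
case: (ex_minnP ex) => j hj jmin.
have jn : theta ^+ j <= E n.
  case: j hj jmin => [|j] hj jmin.
    by apply: le_trans EJ; rewrite ler_weXn2l// ltW.
  by rewrite leNgt; apply/negP => /jmin; rewrite ltnn.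
have Jj : (J <= j)%N.
  rewrite -ltnS ltnNge; apply/negP => jJ.
  have : theta ^+ j.+1 <= theta ^+ J by rewrite ler_weXn2l// ltW.
  lra.
have [lj1 lj2] := hl j; have [lS1 lS2] := hl j.+1.
have lo : (level j <= n)%N.
  by rewrite leqNgt; apply/negP => /lj2; lra.
have hi : (n <= level j.+1)%N.
  rewrite leqNgt; apply/negP => /ltnW/expected_le; lra.
have EhiS : E (level j.+1) <= theta ^+ j.+1 + 1.
  case: (level j.+1) lS2 => [|k] h.
    by rewrite /expected big_geq// addr_ge0// exprn_ge0//; lra.
  rewrite /expected big_nat_recr//= -/(expected rho k).
  by apply: lerD; [exact/ltW/h|exact: ball_meas_le1].
have tS : theta ^+ j.+1 = theta ^+ j * theta by rewrite exprSr.
have c1 := close _ Jj; have c2 := close _ (leq_trans Jj (leqnSn j)).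
have f1 := hit_count_le _ _ x lo; have f2 := hit_count_le _ _ x hi.
move: c1 c2; rewrite !ltr_norml => /andP[c1 _] /andP[_ c2].
have EjE : E n <= theta * E (level j).
  apply: (@le_trans _ _ (theta ^+ j.+1)); first exact: ltW.
  by rewrite exprS ler_wpM2l//; lra.
have EhE : E (level j.+1) <= theta * E n + 1.
  apply: (le_trans EhiS); rewrite lerD2r exprS ler_wpM2l//; lra.
have En0 : 0 < E n by apply: lt_le_trans jn; rewrite exprn_gt0//; lra.
have Ej0 : 0 < E (level j) by apply: lt_le_trans lj1; rewrite exprn_gt0//; lra.
rewrite ler_norml; apply/andP; split.
- have : (1 - eps) * E n <= (1 - eps) * (theta * E (level j)).
    by rewrite ler_wpM2l//; lra.
  have : eps * E (level j) <= eps * E n.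
    by rewrite ler_pM2l//; exact: expected_le.
  have : 0 <= eps ^+ 2 * E (level j) by rewrite mulr_ge0 ?sqr_ge0// ltW.
  rewrite /theta expr2; lra.
- have : eps * E (level j.+1) <= eps * (theta * E n + 1) by rewrite ler_pM2l.
  have : eps ^+ 2 * E n <= eps * E n.
    by rewrite ler_pM2r// expr2 ler_piMr// ltW.
  move: EhE; rewrite /theta expr2; lra.
Qed.

Theorem hit_count_asymptotic : {ae @lebesgue_measure R, forall x : R, 0 <= x < 1 ->
  forall eps, 0 < eps -> exists M, forall n, (M <= n)%N ->
    `|hit_count T rho n x - E n| <= eps * E n}.
Proof.
pose eps (k : nat) : R := k.+1%:R^-1.
have e0 k : 0 < eps k by rewrite invr_gt0 ltr0n.
have e1 k : eps k <= 1 by rewrite invf_le1 ?ltr0n// ler1n.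
have t1 k : 1 < 1 + eps k by rewrite ltrDl.
have [level hl] := choice (fun k => level_exists (1 + eps k)).
have := ae_foralln (fun k => level_deviation_ae (eps k) (1 + eps k) (level k) (e0 k) (t1 k)
  (fun j => (hl k j).1)).
apply: filterS => x hx x01 e egt0.
pose k := Num.truncn (6 / e).
have [J hJ] := hx k x01.
have [M hM] := interpolation (eps k) (level k) x J (e0 k) (e1 k) (hl k) hJ.
exists M => n Mn; apply: (le_trans (hM n Mn)); rewrite ler_wpM2r//.
  by apply: sumr_ge0 => j _; exact/ltW/ball_meas_gt0.
rewrite ler_pdivrMr ?ltr0n// -ler_pdivrMl//.
by rewrite mulrC ltW// truncnS_gt.
Qed.

End Convergence.

(** * Sums of radii and the theorem *)

Section Radii.
Context {R : realType} (rho : nat -> R).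
Hypothesis rho_gt0 : forall j, 0 < rho j.
Hypothesis rho_noninc : forall i j, (i <= j)%N -> rho j <= rho i.

(** [2 * rho j] is at most a constant times [ball_meas (rho j)], as the radii are
    bounded. *)
Lemma expected_unbounded : (forall M, exists n, M <= \sum_(0 <= j < n) rho j) ->
  forall M, exists n, M <= expected rho n.
Proof.
move=> rho_div M.
pose c := 1 + 2 * rho 0%N; have c0 : 0 < c by rewrite /c; have := rho_gt0 0%N; lra.
have [n hn] := rho_div (c / 2 * M); exists n.
have h : 2 / c * \sum_(0 <= j < n) rho j <= expected rho n.
  rewrite mulr_sumr; apply: ler_sum => j _; rewrite /ball_meas.
  rewrite mulrAC ler_pdivrMr//.
  have rj := rho_gt0 j; have r0 : rho j <= rho 0%N by exact: rho_noninc.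
  case: (leP 1 (2 * rho j)) => h; first by rewrite /c; lra.
  by rewrite ler_peMr// ?mulr_ge0// ?ltW// /c ltrDl; have := rho_gt0 0%N; lra.
apply: le_trans h.
have -> : M = 2 / c * (c / 2 * M) by field; lra.
by rewrite ler_pM2l// divr_gt0.
Qed.

(** The two sums differ by the excess of [2 * rho j] over 1, which tends to 0
    and occurs only for balls of measure 1. *)
Lemma expected_equiv : (forall M, exists n, M <= expected rho n) ->
  (forall e, 0 < e -> exists J, forall j, (J <= j)%N -> rho j <= 2^-1 + e) ->
  forall e, 0 < e -> exists M, forall n, (M <= n)%N ->
  `|\sum_(0 <= j < n) 2 * rho j - expected rho n| <= e * expected rho n.
Proof.
move=> E_unb rho_lim e e0.
have e4 : 0 < e / 4 by rewrite divr_gt0.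
have [J hJ] := rho_lim _ e4.
have exc0 j : 0 <= 2 * rho j - ball_meas (rho j).
  by rewrite subr_ge0 /ball_meas ge_min lexx orbT.
have exc j : (J <= j)%N -> 2 * rho j - ball_meas (rho j) <= e / 2 * ball_meas (rho j).
  move=> /hJ; rewrite /ball_meas; have := rho_gt0 j.
  case: (leP 1 (2 * rho j)) => h r0 rj; first by lra.
  by rewrite subrr mulr_ge0// ?mulr_ge0// ltW// divr_gt0.
pose C := \sum_(0 <= j < J) (2 * rho j - ball_meas (rho j)).
have [M0 hM0] := E_unb (C / (e / 2)).
exists (maxn M0 J) => n; rewrite geq_max => /andP[Mn Jn].
have EM : C <= e / 2 * expected rho n.
  rewrite mulrC -ler_pdivrMr ?divr_gt0//; apply: (le_trans hM0).
  by rewrite expected_le.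
rewrite /expected -sumrB ger0_norm ?sumr_ge0//.
rewrite (big_cat_nat (leq0n J) Jn)/= -/C.
have : \sum_(J <= j < n) (2 * rho j - ball_meas (rho j)) <= e / 2 * expected rho n.
  apply: (@le_trans _ _ (e / 2 * \sum_(J <= j < n) ball_meas (rho j))).
    rewrite mulr_sumr big_seq [leRHS]big_seq; apply: ler_sum => j.
    by rewrite mem_index_iota => /andP[/exc].
  rewrite ler_wpM2l//; first by rewrite ltW// divr_gt0.
  rewrite /expected [leRHS](big_cat_nat (leq0n J) Jn)/= lerDr.
  by apply: sumr_ge0 => j _; exact/ltW/ball_meas_gt0.
rewrite -/(expected rho n); move: EM; lra.
Qed.

End Radii.

Section SeriesOfRadii.
Context {R : realType} (r : nat -> R).
Hypothesis r_ge0 : forall i, 0 <= r i.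
Hypothesis r_noninc : nonincreasing_seq r.
Hypothesis r_div : ~ cvgn (series r).

Lemma series_unbounded M : exists n, M <= \sum_(0 <= j < n) r j.+1.
Proof.
apply: contrapT => /forallNP h; apply: r_div; apply: nondecreasing_is_cvgn.
  by apply/nondecreasing_seqP => n; rewrite /series/= big_nat_recr//= lerDl.
exists (r 0%N + `|M|) => _ [n _ <-]; rewrite /series/=.
case: n => [|n]; first by rewrite big_geq// addr_ge0.
rewrite big_nat_recl// lerD2l (le_trans _ (ler_norm _))// leNgt.
by apply/negP => /ltW; exact: h.
Qed.

Lemma radii_gt0 j : 0 < r j.
Proof.
rewrite lt_neqAle r_ge0 andbT; apply/eqP => rj0.
have r0 k : (j <= k)%N -> r k = 0.
  by move=> jk; apply/eqP; rewrite eq_le r_ge0 andbT [leRHS]rj0; exact: r_noninc.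
have [n hn] := series_unbounded (\sum_(0 <= i < j) r i.+1 + 1).
have : \sum_(0 <= i < n) r i.+1 <= \sum_(0 <= i < j) r i.+1.
  have [nj|/ltnW jn] := leqP n j.
    rewrite [leRHS](big_cat_nat (leq0n n) nj)/= lerDl; exact: sumr_ge0.
  rewrite (big_cat_nat (leq0n j) jn)/= [X in _ + X]big1_seq ?addr0// => i.
  by rewrite mem_index_iota/= => /andP[ji _]; apply: r0; exact: ltnW.
lra.
Qed.

Lemma radii_lim : limn r <= 2^-1 -> forall e, 0 < e ->
  exists J, forall j, (J <= j)%N -> r j <= 2^-1 + e.
Proof.
move=> r_lim e e0.
have cv : cvgn r.
  by apply: nonincreasing_is_cvgn => //; exists 0 => _ [n _ <-].
have /cvgrPdist_lt /(_ e e0) [J _ hJ] : r @ \oo --> limn r by exact: cv.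
exists J => j /hJ/=; rewrite ltr_norml => /andP[h _]; lra.
Qed.

End SeriesOfRadii.

Lemma cvg_ratio {R : realType} (F E S : nat -> R) :
  (forall M, exists n, forall m, (n <= m)%N -> M <= E m) ->
  (forall e, 0 < e -> exists M, forall n, (M <= n)%N -> `|F n - E n| <= e * E n) ->
  (forall e, 0 < e -> exists M, forall n, (M <= n)%N -> `|S n - E n| <= e * E n) ->
  F n / S n @[n --> \oo] --> (1 : R).
Proof.
move=> E_oo hF hS; apply/cvgrPdist_le => e e0.
pose d := Num.min (e / 4) (2^-1).
have [d0 d1 d2] : [/\ 0 < d, d <= e / 4 & d <= 2^-1].
  split; rewrite /d ?ge_min ?lexx ?orbT// lt_min divr_gt0//=; lra.
have [M1 h1] := hF d d0; have [M2 h2] := hS d d0; have [M3 h3] := E_oo 1.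
exists (maxn M1 (maxn M2 M3)) => // n /=; rewrite !geq_max => /and3P[/h1 f /h2 s /h3 En].
have E0 : 0 < E n by lra.
have dE : d * E n <= 2^-1 * E n by rewrite ler_wpM2r// ltW.
move: (s); rewrite ler_norml => /andP[s1 s2].
have S0 : 2^-1 * E n <= S n by lra.
have Spos : 0 < S n by lra.
have -> : 1 - F n / S n = (S n - F n) / S n by field; lra.
rewrite normrM normfV (gtr0_norm Spos) ler_pdivrMr//.
have -> : S n - F n = (S n - E n) - (F n - E n) by ring.
apply: (le_trans (ler_normB _ _)).
apply: (@le_trans _ _ (2 * (d * E n))); first by lra.
have h : d * E n <= e / 4 * E n by rewrite ler_wpM2r// ltW.
have : e * (2^-1 * E n) <= e * S n by rewrite ler_pM2l.
lra.
Qed.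

(* [limn r <= 2^-1] only excludes targets that contain [0, 1) for ever, with
   2 r_j bounded away from the measure of the target: there the ratio tends
   to 1 / (2 lim r) < 1. *)
Theorem theorem3p1 (R : realType) (d : nat) (l : 'I_d -> R) (pi : 'S_d)
    (r : nat -> R) :
  (2 <= d)%N ->
  (forall i, 0 <= l i) ->
  \sum_(i < d) l i = 1 ->
  keane l pi ->
  (exists sigma : R, 0 < sigma /\
     forall n : nat, (0 < n)%N -> ((sigma / n%:R)%:E < min_gap l pi n)%E) ->
  (forall i, 0 <= r i) ->
  nonincreasing_seq r ->
  ~ cvgn (series r) ->
  limn r <= 2^-1 ->
  {ae (@lebesgue_measure R), forall x : R, 0 <= x < 1 ->
     (\sum_(1 <= j < N.+1) \1_(ball (2^-1 : R) (r j)) (iter j (iet l pi) x)) /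
     (\sum_(1 <= j < N.+1) 2 * r j) @[N --> \oo] --> (1 : R)}.
Proof.
move=> d2 l0 l1 kn gap r_ge0 r_noninc r_div r_lim.
have [s exch] := keane_exchange l pi d2 l0 l1 kn gap.
have [C [K [K0 shadow]]] := exchange_shadowing _ _ _ exch.
pose T := iet l pi.
have T_unit := exch_unit _ _ _ exch.
have T_meas := measurable_iter _ _ _ exch.
have T_umeas := umeas_iter _ _ _ exch.
have [a [B [a0 B4 rate]]] := equidistributed_rate T T_unit T_meas T_umeas C K K0 shadow.
pose rho j := r j.+1.
have rho_gt0 j : 0 < rho j by exact: (radii_gt0 r r_ge0 r_noninc r_div).
have rho_noninc i j : (i <= j)%N -> rho j <= rho i by move=> ij; exact: r_noninc.
have E_unb := expected_unbounded rho rho_gt0 rho_noninc (series_unbounded r r_ge0 r_div).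
have rho_lim e : 0 < e -> exists J, forall j, (J <= j)%N -> rho j <= 2^-1 + e.
  move=> /(radii_lim r r_ge0 r_noninc r_lim)[J hJ].
  by exists J => j Jj; apply: hJ; rewrite ltnW// ltnS.
have [A [mA A0 hA]] :=
  hit_count_asymptotic T T_unit T_meas T_umeas rho rho_gt0 rho_noninc a B a0 B4 rate E_unb.
exists A; split => // x /= nx; apply: hA => /= asymp; apply: nx => x01.
have {asymp} hx := asymp x01.
have := cvg_ratio (fun n => hit_count T rho n x) (expected rho) (fun n => \sum_(0 <= j < n) 2 * rho j).
have -> : (fun N => hit_count T rho N x / \sum_(0 <= j < N) 2 * rho j) =
  (fun N => (\sum_(1 <= j < N.+1) \1_(ball (2^-1 : R) (r j)) (iter j (iet l pi) x)) /
     (\sum_(1 <= j < N.+1) 2 * r j)).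
  by apply/funext => N; rewrite !big_add1/=.
apply; [|exact: hx|exact: expected_equiv].
move=> M; have [n hn] := E_unb M; exists n => m nm; apply: (le_trans hn).
exact: expected_le.
Qed.
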